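(* Let $k$ be an algebraically closed field, let $\Lambda$ be a basic finite-dimensional $k$-algebra, let $\{e_1,\dots,e_n\}$ be a complete set of primitive pairwise orthogonal idempotents of $\Lambda$, let $J$ be a non-empty subset of $[n]=\{1,\dots,n\}$, and let $e_J := \sum_{j\in J} e_j$. Then the support $\tau$-tilting complex of the algebra $e_J\Lambda e_J$ is isomorphic, as a simplicial complex, to the subcomplex of the support $\tau$-tilting complex of $\Lambda$ induced by those vertices (isomorphism classes of indecomposable $\tau$-rigid pairs) whose $\mathbf{g}$-vectors have all coordinates with index outside of $J$ equal to zero.
   Context: Modules are finite-dimensional right modules; $\operatorname{mod}\Lambda$ is their category, $\operatorname{proj}\Lambda$ the full subcategory of projective modules, and $\tau$ the Auslander--Reiten translation of $\operatorname{mod}\Lambda$. A module $M$ is $\tau$-rigid if $\operatorname{Hom}_\Lambda(M,\tau M)=0$. A pair $(M,P)$ with $M\in\operatorname{mod}\Lambda$ and $P\in\operatorname{proj}\Lambda$ is a $\tau$-rigid pair if $M$ is $\tau$-rigid and $\operatorname{Hom}_\Lambda(P,M)=0$. Direct sums of pairs are taken componentwise; so an indecomposable pair has the form $(M,0)$ with $M$ indecomposable or $(0,P)$ with $P$ indecomposable projective. The support $\tau$-tilting complex of $\Lambda$ is the simplicial complex whose vertices are the isomorphism classes of indecomposable $\tau$-rigid pairs and whose faces are the finite sets of such pairs whose direct sum is a $\tau$-rigid pair. (Its facets correspond to the basic support $\tau$-tilting pairs.) The $\mathbf{g}$-vector of a $\tau$-rigid pair $(M,P)$ is defined as follows: let $P_1^M\to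 P_0^M$ be a minimal projective presentation of $M$, and write $P_0^M\cong\bigoplus_{i\in[n]}(e_i\Lambda)^{\oplus a_i}$ and $P_1^M\oplus P\cong\bigoplus_{i\in[n]}(e_i\Lambda)^{\oplus b_i}$; the $\mathbf{g}$-vector is $(a_i-b_i)_{i\in[n]}\in\mathbb{Z}^n$. The subcomplex of a simplicial complex induced by a set $V$ of vertices consists of all faces all of whose vertices belong to $V$. *)

(* Defs.v *)
From HB Require Import structures.
From mathcomp Require Import all_boot all_order all_algebra all_field.

Set Implicit Arguments.
Unset Strict Implicit.
Unset Printing Implicit Defensive.

Import GRing.Theory.
Local Open Scope ring_scope.

(* Finite-dimensional right modules: [ract x a] is x . a. *)
Record rmodule (k : fieldType) (L : falgType k) := RModule {
  rcar :> vectType k;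
  ract : rcar -> L -> rcar;
  ract_linl : forall a, linear (fun x => ract x a);
  ract_linr : forall x, linear (ract x);
  ract1 : forall x, ract x 1 = x;
  ractA : forall x a b, ract x (a * b) = ract (ract x a) b }.

Record lmodule (k : fieldType) (L : falgType k) := LModule {
  lcar :> vectType k;
  lact : L -> lcar -> lcar;
  lact_linl : forall a, linear (lact a);
  lact_linr : forall x, linear (fun a => lact a x);
  lact1 : forall x, lact 1 x = x;
  lactA : forall a b x, lact (a * b) x = lact a (lact b x) }.

Section Modules.
Variables (k : fieldType) (L : falgType k).
Implicit Types (M N P Q : rmodule L) (S T : lmodule L).

Definition ractr M (a : L) (x : M) : M := ract x a.
HB.instance Definition _ M a :=
  GRing.isLinear.Build k M M _ (@ractr M a) (@ract_linl k L M a).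
Definition ractf M (a : L) : 'End(M) := linfun (@ractr M a).
Lemma ractfE M a (x : M) : ractf M a x = ract x a.
Proof. by rewrite lfunE. Qed.

HB.instance Definition _ M (x : M) :=
  GRing.isLinear.Build k L M _ (@ract k L M x) (@ract_linr k L M x).

HB.instance Definition _ T a :=
  GRing.isLinear.Build k T T _ (@lact k L T a) (@lact_linl k L T a).
Definition lactf T (a : L) : 'End(T) := linfun (@lact k L T a).
Lemma lactfE T a (x : T) : lactf T a x = lact a x.
Proof. by rewrite lfunE. Qed.

Definition is_rhom M N (f : 'Hom(M, N)) : Prop :=
  forall (x : M) (a : L), f (ract x a) = ract (f x) a.

Definition is_lhom S T (f : 'Hom(S, T)) : Prop :=
  forall (a : L) (x : S), f (lact a x) = lact a (f x).

Definition hom_zero M N : Prop := forall f : 'Hom(M, N), is_rhom f -> f = 0.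

Definition rmod_iso M N : Prop :=
  exists2 f : 'Hom(M, N), is_rhom f & bijective f.

Definition rmod_zero M : Prop := forall x : M, x = 0.

Definition is_submod M (U : {vspace M}) : Prop :=
  forall (x : M) (a : L), x \in U -> ract x a \in U.

Definition superfluous M (K : {vspace M}) : Prop :=
  forall U : {vspace M}, is_submod U -> (U + K)%VS = fullv -> U = fullv.

Section Sub.
Variables (M : rmodule L) (U : {vspace M}) (hU : is_submod U).
Definition sub_act (x : subvs_of U) (a : L) : subvs_of U :=
  vsproj U (ract (vsval x) a).
Lemma sub_actE x a : vsval (sub_act x a) = ract (vsval x) a.
Proof. by rewrite vsprojK //; apply/hU/subvsP. Qed.
Fact sub_act_linl a : linear (fun x => sub_act x a).
Proof. by move=> c x y; rewrite /sub_act linearP /= ract_linl linearP. Qed.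
Fact sub_act_linr x : linear (sub_act x).
Proof. by move=> c a b; rewrite /sub_act ract_linr linearP. Qed.
Fact sub_act1 x : sub_act x 1 = x.
Proof. by apply: subvs_inj; rewrite sub_actE ract1. Qed.
Fact sub_actA x a b : sub_act x (a * b) = sub_act (sub_act x a) b.
Proof. by apply: subvs_inj; rewrite !sub_actE ractA. Qed.
Definition sub_rmod : rmodule L :=
  RModule sub_act_linl sub_act_linr sub_act1 sub_actA.
End Sub.

Definition zero_rmod : rmodule L.
Proof.
exists 'rV[k]_0 (fun x _ => x) => //.
by move=> x c a b; rewrite [LHS]thinmx0 [RHS]thinmx0.
Defined.

Section DirectSum.
Variables M N : rmodule L.
Definition dsum_act (x : M * N) (a : L) : M * N := (ract x.1 a, ract x.2 a).
Fact dsum_act_linl a : linear (fun x => dsum_act x a).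
Proof. by move=> c x y; congr pair; rewrite /= ract_linl. Qed.
Fact dsum_act_linr x : linear (dsum_act x).
Proof. by move=> c a b; congr pair; rewrite /= ract_linr. Qed.
Fact dsum_act1 x : dsum_act x 1 = x.
Proof. by case: x => x y; rewrite /dsum_act !ract1. Qed.
Fact dsum_actA x a b : dsum_act x (a * b) = dsum_act (dsum_act x a) b.
Proof. by rewrite /dsum_act !ractA. Qed.
Definition dsum_rmod : rmodule L :=
  RModule dsum_act_linl dsum_act_linr dsum_act1 dsum_actA.
End DirectSum.

Definition bigdsum_rmod (s : seq (rmodule L)) : rmodule L :=
  foldr dsum_rmod zero_rmod s.

Definition reg_rmod : rmodule L.
Proof.
exists L (fun x a => x * a).
- by move=> a c x y; rewrite mulrDl scalerAl.
- by move=> x c a b; rewrite mulrDr scalerAr.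
- exact: mulr1.
- exact: mulrA.
Defined.

Fact pid_is_submod (e : L) : is_submod (M := reg_rmod) (limg (amull e)).
Proof.
move=> x a /memv_imgP [y _ ->]; rewrite lfunE /= -mulrA.
by rewrite -[e * _](lfunE (e \*o @idfun L)) memv_img ?memvf.
Qed.

Definition pid_rmod (e : L) : rmodule L := sub_rmod (@pid_is_submod e).

(* It is enough to test equivariance on a basis of L. *)
Definition homv_test M N (a : L) (f : 'Hom(M, N)) : 'Hom(M, N) :=
  ((f \o ractf M a) - (ractf N a \o f))%VF.
Fact homv_test_linear M N a : linear (@homv_test M N a).
Proof.
move=> c f g; rewrite /homv_test comp_lfunDl comp_lfunDr.
by rewrite -comp_lfunZl -comp_lfunZr scalerBr opprD addrACA.
Qed.
HB.instance Definition _ M N a :=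
  GRing.isLinear.Build k _ _ _ (@homv_test M N a) (@homv_test_linear M N a).

Definition homv M N : {vspace 'Hom(M, N)} :=
  (\bigcap_(i < \dim {:L}) lker (linfun (homv_test (vbasis {:L})`_i)))%VS.

Lemma homvP M N (f : 'Hom(M, N)) : reflect (is_rhom f) (f \in homv M N).
Proof.
rewrite memvE; apply: (iffP subv_bigcapP) => [h x a|h i _]; last first.
  rewrite -memvE memv_ker lfunE /=; apply/eqP/lfunP => x.
  by rewrite add_lfunE opp_lfunE !comp_lfunE !ractfE h subrr zero_lfunE.
rewrite (coord_vbasis (memvf a)) !linear_sum /=; apply: eq_bigr => i _.
rewrite !linearZ /=; congr (_ *: _); have := h i isT.
rewrite -memvE memv_ker lfunE /= => /eqP /lfunP /(_ x).
rewrite add_lfunE opp_lfunE !comp_lfunE !ractfE zero_lfunE.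
by move/eqP; rewrite subr_eq0 => /eqP.
Qed.

Section LDual.
Variable P : rmodule L.
Let H := subvs_of (homv P reg_rmod).
(* (a . h)(x) = a h(x) *)
Definition ldual_act (a : L) (h : H) : H :=
  vsproj _ ((amull a : 'Hom(reg_rmod, reg_rmod)) \o vsval h)%VF.
Lemma ldual_actE a h x : vsval (ldual_act a h) x = a * vsval h x :> L.
Proof.
rewrite vsprojK ?comp_lfunE ?lfunE //; apply/homvP => y b.
rewrite !comp_lfunE; have /homvP -> := subvsP h.
by rewrite !lfunE /= mulrA.
Qed.
Fact ldual_act_linl a : linear (ldual_act a).
Proof.
by move=> c h g; rewrite /ldual_act !linearP /= comp_lfunDr -comp_lfunZr linearP.
Qed.
Fact ldual_act_linr h : linear (fun a => ldual_act a h).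
Proof.
by move=> c a b; rewrite /ldual_act linearP /= comp_lfunDl -comp_lfunZl linearP.
Qed.
Fact ldual_act1 h : ldual_act 1 h = h.
Proof. by apply/subvs_inj/lfunP => x; rewrite ldual_actE mul1r. Qed.
Fact ldual_actA a b h : ldual_act (a * b) h = ldual_act a (ldual_act b h).
Proof. by apply/subvs_inj/lfunP => x; rewrite !ldual_actE mulrA. Qed.
Definition ldual : lmodule L :=
  LModule ldual_act_linl ldual_act_linr ldual_act1 ldual_actA.
End LDual.

Section KDual.
Variable T : lmodule L.
(* (phi . a)(t) = phi (a t) *)
Definition kdual_act (phi : 'Hom(T, k^o)) (a : L) : 'Hom(T, k^o) :=
  (phi \o lactf T a)%VF.
Lemma kdual_actE phi a t : kdual_act phi a t = phi (lact a t).
Proof. by rewrite comp_lfunE lactfE. Qed.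
Fact kdual_act_linl a : linear (fun phi => kdual_act phi a).
Proof. by move=> c f g; rewrite /kdual_act comp_lfunDl -comp_lfunZl. Qed.
Fact kdual_act_linr phi : linear (kdual_act phi).
Proof.
move=> c a b; apply/lfunP => t.
by rewrite add_lfunE scale_lfunE !kdual_actE lact_linr linearP.
Qed.
Fact kdual_act1 phi : kdual_act phi 1 = phi.
Proof. by apply/lfunP => t; rewrite kdual_actE lact1. Qed.
Fact kdual_actA phi a b : kdual_act phi (a * b) = kdual_act (kdual_act phi a) b.
Proof. by apply/lfunP => t; rewrite !kdual_actE lactA. Qed.
Definition kdual : rmodule L :=
  RModule kdual_act_linl kdual_act_linr kdual_act1 kdual_actA.
End KDual.

Definition projective P : Prop :=
  forall M N (p : 'Hom(M, N)) (g : 'Hom(P, N)),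
    is_rhom p -> is_rhom g -> limg p = fullv ->
    exists2 h : 'Hom(P, M), is_rhom h & (p \o h)%VF = g.

(* [p : P -> M], corestricted to its image, is a projective cover. *)
Definition projective_cover_of_image P M (p : 'Hom(P, M)) : Prop :=
  [/\ projective P, is_rhom p & superfluous (lker p)].

Definition min_proj_presentation P1 P0 M
    (f : 'Hom(P1, P0)) (p : 'Hom(P0, M)) : Prop :=
  [/\ projective_cover_of_image p, limg p = fullv,
      projective_cover_of_image f & limg f = lker p].

(* T is the cokernel of f^* : Hom_L(P0, L) -> Hom_L(P1, L), h |-> h o f. *)
Definition is_transpose P1 P0 (f : 'Hom(P1, P0)) T : Prop :=
  exists q : 'Hom(ldual P1, T),
    [/\ is_lhom q, limg q = fullv
      & forall h : ldual P1, q h = 0 <->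
          exists g : ldual P0, vsval h = (vsval g \o f)%VF].

(* N is isomorphic to D Tr M.  This is a relation because the presentation, the
   cokernel Tr M, and hence tau M, are determined only up to isomorphism. *)
Definition is_AR_translate M N : Prop :=
  exists P1 P0 (f : 'Hom(P1, P0)) (p : 'Hom(P0, M)) T,
    [/\ min_proj_presentation f p, is_transpose f T & rmod_iso N (kdual T)].

Definition tau_rigid M : Prop :=
  exists2 N, is_AR_translate M N & hom_zero M N.

Definition rpair : Type := (rmodule L * rmodule L)%type.
Implicit Types X Y Z : rpair.

Definition tau_rigid_pair X : Prop :=
  [/\ tau_rigid X.1, projective X.2 & hom_zero X.2 X.1].

Definition pair_iso X Y : Prop := rmod_iso X.1 Y.1 /\ rmod_iso X.2 Y.2.

Definition pair_zero X : Prop := rmod_zero X.1 /\ rmod_zero X.2.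

Definition dsum_pair X Y : rpair := (dsum_rmod X.1 Y.1, dsum_rmod X.2 Y.2).

Definition bigdsum_pair (s : seq rpair) : rpair :=
  foldr dsum_pair (zero_rmod, zero_rmod) s.

Definition indecomposable_pair X : Prop :=
  ~ pair_zero X /\
  forall Y Z, pair_iso X (dsum_pair Y Z) -> pair_zero Y \/ pair_zero Z.

(* Isomorphism classes are genuine classes, represented as predicates; [set]
   of mathcomp-classical is at too low a universe level for [rpair]. *)
Definition iso_class X : rpair -> Prop := fun Y => pair_iso X Y.

Definition indec_tau_rigid_pair X : Prop :=
  indecomposable_pair X /\ tau_rigid_pair X.

Definition idempotent_elt (e : L) : Prop := e * e = e.

Definition primitive_idempotent (e : L) : Prop :=
  [/\ idempotent_elt e, e != 0
    & forall f g : L, idempotent_elt f -> idempotent_elt g ->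
        f * g = 0 -> g * f = 0 -> e = f + g -> f = 0 \/ g = 0].

Definition complete_primitive_idempotents n (e : 'I_n -> L) : Prop :=
  [/\ forall i, primitive_idempotent (e i),
      forall i j, i != j -> e i * e j = 0
    & \sum_(i < n) e i = 1].

Definition basic_algebra : Prop :=
  forall n (e : 'I_n -> L), complete_primitive_idempotents e ->
    forall i j, rmod_iso (pid_rmod (e i)) (pid_rmod (e j)) -> i = j.

Definition idem_sum n (e : 'I_n -> L) (J : {set 'I_n}) : L :=
  \sum_(j in J) e j.

Lemma idem_sum_mull n (e : 'I_n -> L) (J : {set 'I_n}) j :
  complete_primitive_idempotents e -> j \in J -> e j * idem_sum e J = e j.
Proof.
case=> prim orth _ jJ; rewrite mulr_sumr (bigD1 j) //= big1 => [|i /andP[_ ij]].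
  by rewrite addr0; case: (prim j).
by rewrite orth // eq_sym.
Qed.

Lemma idem_sum_idem n (e : 'I_n -> L) (J : {set 'I_n}) :
  complete_primitive_idempotents e -> idempotent_elt (idem_sum e J).
Proof.
move=> he; rewrite /idempotent_elt {1}/idem_sum mulr_suml.
by apply: eq_bigr => j jJ; rewrite idem_sum_mull.
Qed.

Lemma idem_sum_neq0 n (e : 'I_n -> L) (J : {set 'I_n}) :
  complete_primitive_idempotents e -> J != set0 -> idem_sum e J != 0.
Proof.
move=> he /set0Pn [j jJ]; have [prim _ _] := he; have [_ ej0 _] := prim j.
by apply: contraNneq ej0 => eJ0; rewrite -(idem_sum_mull he jJ) eJ0 mulr0.
Qed.

(* The subspace eLe; as a subalgebra of L in the sense of [aspace] its unit
   [algid] is e, not 1. *)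
Definition corner_vspace (e : L) : {vspace L} :=
  limg (amull e \o amulr e)%VF.

Lemma corner_vspaceP (e x : L) : idempotent_elt e ->
  reflect (e * x = x /\ x * e = x) (x \in corner_vspace e).
Proof.
move=> ee; apply: (iffP memv_imgP) => [[y _ ->]|[ex xe]].
  by rewrite comp_lfunE !lfunE /= ?lfunE /= -!mulrA ee !mulrA ee.
by exists x; rewrite ?memvf // comp_lfunE !lfunE /= ?lfunE /= xe ex.
Qed.

Fact corner_is_aspace (e : L) :
  idempotent_elt e -> e != 0 -> is_aspace (corner_vspace e).
Proof.
move=> ee e0; apply/andP; split.
  apply/has_algidP; exists e; split=> //; first by apply/corner_vspaceP.
  by move=> x /(corner_vspaceP _ ee).
apply/prodvP => x y /(corner_vspaceP _ ee) [ex xe] /(corner_vspaceP _ ee) [ey ye].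
by apply/corner_vspaceP => //; rewrite mulrA ex -mulrA ye.
Qed.

Definition corner (e : L) (ee : idempotent_elt e) (e0 : e != 0) : {aspace L} :=
  ASpace (corner_is_aspace ee e0).

Definition idem_corner n (e : 'I_n -> L) (J : {set 'I_n})
    (he : complete_primitive_idempotents e) (hJ : J != set0) : falgType k :=
  subvs_of (corner (idem_sum_idem J he) (idem_sum_neq0 he hJ)).

Lemma algid_corner (e : L) (ee : idempotent_elt e) (e0 : e != 0) :
  algid (corner ee e0) = e.
Proof.
have eC : e \in corner ee e0 by apply/corner_vspaceP.
have /(corner_vspaceP _ ee) [<- _] := memv_algid (corner ee e0).
by rewrite algidr.
Qed.

Definition proj_sum n (e : 'I_n -> L) (a : 'I_n -> nat) : rmodule L :=
  bigdsum_rmod (flatten [seq nseq (a i) (pid_rmod (e i)) | i <- enum 'I_n]).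

Definition is_gvector n (e : 'I_n -> L) X (g : 'I_n -> int) : Prop :=
  exists P1 P0 (f : 'Hom(P1, P0)) (p : 'Hom(P0, X.1)) (a b : 'I_n -> nat),
    [/\ min_proj_presentation f p,
        rmod_iso P0 (proj_sum e a),
        rmod_iso (dsum_rmod P1 X.2) (proj_sum e b)
      & forall i, g i = (a i)%:Z - (b i)%:Z].

End Modules.

(* Only the data of an abstract simplicial complex, the empty face included:
   that faces are finite sets of vertices closed under passing to subsets is
   not part of the record. *)
Record simplicial_complex := SimplicialComplex {
  sc_point : Type;
  sc_vertex : sc_point -> Prop;
  sc_face : (sc_point -> Prop) -> Prop }.

Definition induced_subcomplex (K : simplicial_complex)
    (V : sc_point K -> Prop) : simplicial_complex :=
  SimplicialComplex (fun v : sc_point K => sc_vertex v /\ V v)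
    (fun F : sc_point K -> Prop => sc_face F /\ forall v, F v -> V v).

Definition sc_iso (K1 K2 : simplicial_complex) : Prop :=
  exists phi : sc_point K1 -> sc_point K2,
    [/\ forall v, sc_vertex v -> sc_vertex (phi v),
        forall v v', sc_vertex v -> sc_vertex v' -> phi v = phi v' -> v = v',
        forall w, sc_vertex w -> exists2 v, sc_vertex v & w = phi v
      & forall F : sc_point K1 -> Prop, (forall v, F v -> sc_vertex v) ->
          sc_face F <-> sc_face (fun w => exists2 v, F v & w = phi v)].

Section Complex.
Variables (k : fieldType) (L : falgType k).

Definition support_tau_tilting_complex : simplicial_complex := {|
  sc_point := rpair L -> Prop;
  sc_vertex := fun c =>
    exists2 X : rpair L, indec_tau_rigid_pair X & c = iso_class X;
  sc_face := fun F =>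
    exists m (X : 'I_m -> rpair L),
      [/\ forall i, indec_tau_rigid_pair (X i),
          forall i j, iso_class (X i) = iso_class (X j) -> i = j,
          forall c, F c <-> exists i, c = iso_class (X i)
        & tau_rigid_pair (bigdsum_pair [seq X i | i <- enum 'I_m])] |}.

Definition gvector_supported n (e : 'I_n -> L) (J : {set 'I_n})
    (c : sc_point support_tau_tilting_complex) : Prop :=
  exists2 X : rpair L, c = iso_class X &
    exists2 g : 'I_n -> int, is_gvector e X g & forall i, i \notin J -> g i = 0.

End Complex.

(* Main.v *)
From HB Require Import structures.
From Stdlib Require Import FunctionalExtensionality PropExtensionality.
From mathcomp Require Import all_boot all_order all_algebra all_field.
Require Import Defs.

(* Let c = e_J and G = cLc.  Restriction N |-> Nc to G-modules is an equivalence
   from the modules with a presentation Q1 -> Q0 by summands of powers of cL onto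
   all G-modules, and identifies those summands with the projective G-modules.
   A module M with minimal presentation f : P1 -> P0 -> M is tau-rigid iff every
   map P1 -> M factors through f, a condition which the equivalence respects, so
   tau-rigid pairs of G are the tau-rigid pairs of L presented by cL.  Finally P0
   and P1 + P have no common summand for a tau-rigid pair (M, P), hence a
   g-vector vanishing outside J says exactly that (M, P) is presented by cL. *)

Set Implicit Arguments.
Unset Strict Implicit.
Unset Printing Implicit Defensive.

Import GRing.Theory.
Local Open Scope ring_scope.

(** * Modules and quotients *)

Section LinearAlgebra.
Variable k : fieldType.
Implicit Types U V W : vectType k.

(** Summands of powers of cL are handled through dual bases: elements p_i = p_i c and maps h_i into
    cL such that x is the sum of the p_i h_i(x). A map out of such a module P is an explicit formula
    in its values at the p_i. Since the p_i lie in Pc and the h_i send Pc into G, the same formula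
    extends a G-map from Pc to P, and presented modules follow by passing to cokernels. Extensions
    are unique because N = NcL, so identities between maps are checked on Nc only.

    The factorization criterion comes from the duality between Hom(N, D Tr M) and the cokernel of
    Hom(P0, N) -> Hom(P1, N). It removes the Auslander-Reiten translate, which need not be presented
    by cL, and leaves only maps between presented modules.

    Isomorphism classes being predicates, the vertex map is written without choosing induced
    modules: a class v over G goes to the class of all presented pairs whose restriction lies in
    v. *)

Lemma linear_linfunE U V (f : U -> V) : linear f -> linfun f =1 f.
Proof.
move=> hf; pose fM := GRing.isLinear.Build k U V _ f hf.
pose g : {linear U -> V} := HB.pack f fM.
exact: (lfunE g).
Qed.

Lemma linear_lfun U V (f : U -> V) :
  linear f -> exists F : 'Hom(U, V), F =1 f.
Proof. by move/linear_linfunE; exists (linfun f). Qed.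

(** The quotient lives on the complement of [U], with x - projv U x as the class of x. The linear
    section [s] serves to carry module actions over to the quotient. *)
Lemma quotient_vspace V (U : {vspace V}) :
  exists (W : vectType k) (p : 'Hom(V, W)) (s : 'Hom(W, V)),
    cancel s p /\ forall x, p x = 0 <-> x \in U.
Proof.
have [p pE] : exists p : 'Hom(V, subvs_of (U^C)%VS),
    p =1 fun x => vsproj (U^C)%VS (x - projv U x).
  apply: linear_lfun => a x y.
  by rewrite -linearP /=; congr vsproj; rewrite linearP opprD addrACA scalerBr.
have pK x : vsval (p x) = x - projv U x by rewrite pE vsprojK ?memv_projC.
exists _, p, (linfun vsval); split=> [w|x].
  apply: subvs_inj; rewrite pK lfunE /=.
  have : vsval w \in lker (projv U) by rewrite lker_proj subvsP.
  by rewrite memv_ker => /eqP ->; rewrite subr0.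
split=> [px0|xU]; last by apply: subvs_inj; rewrite pK projv_id // subrr.
have := pK x; rewrite px0 => /esym/eqP; rewrite subr_eq0 => /eqP ->.
exact: memv_proj.
Qed.

Lemma lfun_separate V (U : {vspace V}) (x : V) :
  x \notin U -> exists2 phi : 'Hom(V, k^o), forall y, y \in U -> phi y = 0
                                          & phi x != 0.
Proof.
have [W [p [s [_ pU]]]] := quotient_vspace U.
move=> /negP xU; have px0 : p x != 0 by apply/eqP=> /pU.
have [i ci] : exists i, coord (vbasis {:W}) i (p x) != 0.
  apply/existsP; apply: contraNT px0 => /existsPn h.
  rewrite (coord_vbasis (memvf (p x))) big1 // => i _.
  by have := h i; rewrite negbK => /eqP ->; rewrite scale0r.
exists (linfun (coord (vbasis {:W}) i : W -> k^o) \o p)%VF => [y /pU py|].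
  by rewrite comp_lfunE py linear0.
by rewrite comp_lfunE lfunE.
Qed.

Lemma surj_lfunP U V (f : 'Hom(U, V)) :
  limg f = fullv <-> forall y, exists x, f x = y.
Proof.
split=> [hf y|hf].
  have := memvf y; rewrite -hf => /memv_imgP[x _ ->]; by exists x.
by apply/vspaceP => y; have [x <-] := hf y; rewrite memvf memv_img ?memvf.
Qed.

End LinearAlgebra.

Section ModuleBasics.
Variables (k : fieldType) (L : falgType k).
Implicit Types M N P Q : rmodule L.

Lemma ractDl M (x y : M) a : ract (x + y) a = ract x a + ract y a.
Proof. exact: (raddfD (@ractr k L M a)). Qed.
Lemma ractBl M (x y : M) a : ract (x - y) a = ract x a - ract y a.
Proof. exact: (raddfB (@ractr k L M a)). Qed.
Lemma ract0l M a : ract (0 : M) a = 0.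
Proof. exact: (raddf0 (@ractr k L M a)). Qed.
Lemma ractZl M b (x : M) a : ract (b *: x) a = b *: ract x a.
Proof. exact: (linearZZ (@ractr k L M a)). Qed.
Lemma ractZr M b (x : M) a : ract x (b *: a) = b *: ract x a.
Proof. exact: (linearZZ (@ract k L M x)). Qed.
Lemma ract_suml M I (r : seq I) (F : I -> M) a :
  ract (\sum_(i <- r) F i) a = \sum_(i <- r) ract (F i) a.
Proof. exact: (raddf_sum (@ractr k L M a)). Qed.
Lemma ract_sumr M (x : M) I (r : seq I) (A : pred I) (F : I -> L) :
  ract x (\sum_(i <- r | A i) F i) = \sum_(i <- r | A i) ract x (F i).
Proof. exact: (raddf_sum (@ract k L M x)). Qed.

Lemma rhom_exists M N (f : M -> N) :
    linear f -> (forall x a, f (ract x a) = ract (f x) a) ->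
  exists2 F : 'Hom(M, N), is_rhom F & F =1 f.
Proof.
move=> /linear_lfun[F FE] hf; exists F => // x a.
by rewrite !FE hf.
Qed.

Lemma id_rhom M : is_rhom (\1%VF : 'Hom(M, M)).
Proof. by move=> x a; rewrite !id_lfunE. Qed.

Lemma comp_rhom M N P (g : 'Hom(N, P)) (f : 'Hom(M, N)) :
  is_rhom g -> is_rhom f -> is_rhom (g \o f)%VF.
Proof. by move=> hg hf x a; rewrite !comp_lfunE hf hg. Qed.

Lemma zero_rhom M N : is_rhom (0 : 'Hom(M, N)).
Proof. by move=> x a; rewrite !zero_lfunE ract0l. Qed.

Lemma sub_rhom M N (f g : 'Hom(M, N)) :
  is_rhom f -> is_rhom g -> is_rhom (f - g).
Proof. by move=> hf hg x a; rewrite !add_lfunE !opp_lfunE hf hg ractBl. Qed.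

Lemma limg_submod M N (f : 'Hom(M, N)) : is_rhom f -> is_submod (limg f).
Proof.
by move=> hf _ a /memv_imgP[x _ ->]; rewrite -hf memv_img ?memvf.
Qed.

Lemma lker_submod M N (f : 'Hom(M, N)) : is_rhom f -> is_submod (lker f).
Proof.
by move=> hf x a; rewrite !memv_ker hf => /eqP ->; rewrite ract0l.
Qed.

Lemma addv_submod M (U V : {vspace M}) :
  is_submod U -> is_submod V -> is_submod (U + V)%VS.
Proof.
move=> hU hV _ a /memv_addP[x xU [y yV ->]].
by rewrite ractDl memv_add ?hU ?hV.
Qed.

Lemma preim_submod M N (f : 'Hom(M, N)) (U : {vspace N}) :
  is_rhom f -> is_submod U -> is_submod (f @^-1: U)%VS.
Proof. by move=> hf hU x a; rewrite -!memv_preim hf => /hU. Qed.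

Lemma img_submod M N (f : 'Hom(M, N)) (U : {vspace M}) :
  is_rhom f -> is_submod U -> is_submod (f @: U)%VS.
Proof.
by move=> hf hU _ a /memv_imgP[x xU ->]; rewrite -hf memv_img ?hU.
Qed.

(** The action lifts a class along [s], acts in [M] and projects back; [pa] says that the choice of
    the lift does not matter. *)
Lemma quotient_rmod M (U : {vspace M}) : is_submod U ->
  exists N (p : 'Hom(M, N)), [/\ is_rhom p, limg p = fullv & lker p = U].
Proof.
move=> hU; have [W [p [s [sK pU]]]] := quotient_vspace U.
have pa x a : p (ract (s (p x)) a) = p (ract x a).
  apply/eqP; rewrite -subr_eq0 -raddfB; apply/eqP/pU.
  rewrite -ractBl; by apply/hU/pU; rewrite linearB /= sK subrr.
have actl a : linear (fun w => p (ract (s w) a)).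
  by move=> c x y; rewrite linearP ract_linl linearP.
have actr w : linear (fun a => p (ract (s w) a)).
  by move=> c x y; rewrite ract_linr linearP.
have act1 w : p (ract (s w) 1) = w by rewrite ract1 sK.
have actA w a b : p (ract (s w) (a * b)) = p (ract (s (p (ract (s w) a))) b).
  by rewrite pa ractA.
exists (RModule actl actr act1 actA), p; split.
- by move=> x a; rewrite /= pa.
- by apply/surj_lfunP => w; exists (s w).
- apply/vspaceP => x; rewrite memv_ker; apply/eqP/idP => [/pU //|].
  by move/pU.
Qed.

Lemma rmod_iso_refl M : rmod_iso M M.
Proof. by exists \1%VF; [apply: id_rhom | exists id => x; rewrite id_lfunE]. Qed.

Lemma rmod_isoP M N : rmod_iso M N <->
  exists (f : 'Hom(M, N)) (g : 'Hom(N, M)),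
    [/\ is_rhom f, is_rhom g, cancel f g & cancel g f].
Proof.
split=> [[f hf [g' gK g'K]]|[f [g [hf hg fK gK]]]]; last first.
  by exists f => //; exists g.
have inj_f := can_inj gK.
have lg : linear g'.
  by move=> a x y; apply: inj_f; rewrite g'K linearP /= !g'K.
have [|g hg gE] := rhom_exists lg.
  by move=> x a; apply: inj_f; rewrite hf !g'K.
by exists f, g; split=> // x; rewrite gE.
Qed.

Lemma rmod_iso_sym M N : rmod_iso M N -> rmod_iso N M.
Proof.
by move/rmod_isoP=> [f [g [hf hg fK gK]]]; apply/rmod_isoP; exists g, f.
Qed.

Lemma rmod_iso_trans M N P : rmod_iso M N -> rmod_iso N P -> rmod_iso M P.
Proof.
move=> [f hf bf] [g hg bg]; exists (g \o f)%VF; first exact: comp_rhom.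
by apply: (eq_bij (bij_comp bg bf)) => x; rewrite comp_lfunE.
Qed.

Lemma rmod_iso_zero M N : rmod_iso M N -> rmod_zero M -> rmod_zero N.
Proof.
move=> /rmod_isoP[f [g [_ _ _ gK]]] M0 x.
by rewrite -(gK x) (M0 (g x)) linear0.
Qed.

Lemma bij_rhom_iso M N (f : 'Hom(M, N)) : is_rhom f ->
  limg f = fullv -> lker f = 0%VS -> rmod_iso M N.
Proof.
move=> hf /surj_lfunP sf kf; exists f => //.
have fK : cancel f (f^-1)%VF by apply: lker0_lfunK; rewrite kf.
by exists (f^-1)%VF => // y; have [x <-] := sf y; rewrite fK.
Qed.

(** The inverse [f^-1] is only a linear section of [f], but two preimages differ by an element of
    ker f, which [g] kills; hence g o f^-1 is equivariant. *)
Lemma rhom_factor M N P (f : 'Hom(M, N)) (g : 'Hom(M, P)) :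
    is_rhom f -> is_rhom g -> limg f = fullv -> (lker f <= lker g)%VS ->
  exists2 h : 'Hom(N, P), is_rhom h & forall x, h (f x) = g x.
Proof.
move=> hf hg sf /subvP kfg; have fV y : f (f^-1%VF y) = y.
  by apply: limg_lfunVK; rewrite sf memvf.
have gf x : g (f^-1%VF (f x)) = g x.
  apply/eqP; rewrite -subr_eq0 -raddfB -memv_ker kfg // memv_ker raddfB /=.
  by rewrite fV subrr.
have [h hh hE] : exists2 h : 'Hom(N, P), is_rhom h & h =1 (g \o f^-1)%VF.
  apply: rhom_exists => [a x y|x a]; first exact: linearP.
  by rewrite !comp_lfunE -{1}(fV x) -hf gf hg.
by exists h => // x; rewrite hE comp_lfunE gf.
Qed.

Lemma same_kernel_iso M N P (f : 'Hom(M, N)) (g : 'Hom(M, P)) :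
  is_rhom f -> is_rhom g -> limg f = fullv -> limg g = fullv ->
  lker f = lker g -> rmod_iso N P.
Proof.
move=> hf hg sf sg kfg; have [|h hh hE] := rhom_factor hf hg sf.
  by rewrite kfg subvv.
apply: (bij_rhom_iso hh).
  apply/surj_lfunP => z; have /surj_lfunP/(_ z)[x <-] := sg.
  by exists (f x).
apply/eqP; rewrite -subv0; apply/subvP => y.
have /surj_lfunP/(_ y)[x <-] := sf; rewrite memv_ker hE.
by rewrite -memv_ker -kfg memv_ker => /eqP ->; apply: mem0v.
Qed.

End ModuleBasics.

(** * Projective modules *)

Section Projectives.
Variables (k : fieldType) (L : falgType k).
Implicit Types (M N P Q : rmodule L) (I : finType) (c : L).

Section Power.
Variables (I : finType) (M : rmodule L).
Definition pow_act (x : {ffun I -> M}) (a : L) : {ffun I -> M} :=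
  [ffun i => ract (x i) a].
Fact pow_act_linl a : linear (fun x => pow_act x a).
Proof. by move=> c x y; apply/ffunP => i; rewrite !ffunE ract_linl. Qed.
Fact pow_act_linr x : linear (pow_act x).
Proof. by move=> c a b; apply/ffunP => i; rewrite !ffunE ract_linr. Qed.
Fact pow_act1 x : pow_act x 1 = x.
Proof. by apply/ffunP => i; rewrite !ffunE ract1. Qed.
Fact pow_actA x a b : pow_act x (a * b) = pow_act (pow_act x a) b.
Proof. by apply/ffunP => i; rewrite !ffunE ractA. Qed.
Definition pow_rmod : rmodule L :=
  RModule pow_act_linl pow_act_linr pow_act1 pow_actA.
End Power.

(** The rank-one map y h. Sums of such maps over a dual basis of [P] exhaust Hom(P, N). *)
Definition ract_hom P N (y : N) (h : 'Hom(P, reg_rmod L)) : 'Hom(P, N) :=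
  (linfun (@ract k L N y) \o h)%VF.

Lemma ract_homE P N (y : N) h (x : P) : ract_hom y h x = ract y (h x).
Proof. by rewrite comp_lfunE lfunE. Qed.

Lemma ract_hom_rhom P N (y : N) (h : 'Hom(P, reg_rmod L)) :
  is_rhom h -> is_rhom (ract_hom y h).
Proof. by move=> hh x a; rewrite !ract_homE hh /= ractA. Qed.

Lemma sum_rhom M N I (f : I -> 'Hom(M, N)) :
  (forall i, is_rhom (f i)) -> is_rhom (\sum_i f i).
Proof.
move=> hf x a; rewrite !sum_lfunE ract_suml.
by apply: eq_bigr => i _; rewrite hf.
Qed.

(* For an idempotent [c], a dual basis exhibits [P] as a direct summand of a
   power of [c L]. *)
Definition dual_basis c P I (p : I -> P) (h : I -> 'Hom(P, reg_rmod L)) :=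
  [/\ forall i, is_rhom (h i), forall i, ract (p i) c = p i,
      forall i x, c * h i x = h i x
    & forall x, x = \sum_i ract (p i) (h i x)].

Definition in_add c P : Prop :=
  exists (I : finType) (p : I -> P) (h : I -> 'Hom(P, reg_rmod L)),
    dual_basis c p h.

(** Expresses M = McL: the only submodule containing Mc is [M]. *)
Definition generated_by c M : Prop :=
  forall U : {vspace M}, is_submod U -> (forall x : M, ract x c \in U) ->
    U = fullv.

Lemma dual_basis_hom c P I (p : I -> P) h N (g : 'Hom(P, N)) :
  dual_basis c p h -> is_rhom g -> forall x, g x = \sum_i ract (g (p i)) (h i x).
Proof.
case=> _ _ _ ph hg x; rewrite {1}[x]ph raddf_sum /=.
by apply: eq_bigr => i _; rewrite hg.
Qed.

(** Choose preimages y_i of the g(p_i) under [f] and send x to the sum of the y_i h_i(x). Asking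
    only for an inclusion of images lets the lemma apply directly to maps into the kernel of a
    presentation. *)
Lemma in_add_lift c P M N (f : 'Hom(M, N)) (g : 'Hom(P, N)) :
    in_add c P -> is_rhom f -> is_rhom g -> (limg g <= limg f)%VS ->
  exists2 u : 'Hom(P, M), is_rhom u & forall x, f (u x) = g x.
Proof.
move=> [I [p [h hP]]] hf hg /subvP gf; have [hh _ _ _] := hP.
exists (\sum_i ract_hom (f^-1%VF (g (p i))) (h i)).
  by apply: sum_rhom => i; apply: ract_hom_rhom.
move=> x; rewrite (dual_basis_hom hP hg) sum_lfunE raddf_sum /=.
apply: eq_bigr => i _; rewrite ract_homE hf limg_lfunVK //.
by rewrite gf ?memv_img ?memvf.
Qed.

Lemma in_add_projective c P : in_add c P -> projective P.
Proof.
move=> hP M N p g hp hg sp; have [|u hu uE] := in_add_lift hP hp hg.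
  by rewrite sp subvf.
by exists u => //; apply/lfunP => x; rewrite comp_lfunE uE.
Qed.

Lemma in_add_generated c P : in_add c P -> generated_by c P.
Proof.
move=> [I [p [h [_ pc _ ph]]]] U hU cU; apply/vspaceP => x; rewrite memvf.
by rewrite (ph x) rpred_sum // => i _; apply: hU; rewrite -pc.
Qed.

Lemma generated_by1 M : generated_by 1 M.
Proof.
by move=> U _ h; apply/vspaceP => x; rewrite memvf -(ract1 x) h.
Qed.

(** As P = PcL, the elements b_i c, for a basis (b_i) of [P], define a surjection from a free
    module. Projectivity splits it, and the coordinates of the splitting, multiplied by c on the
    left, form the dual basis. *)
Lemma projective_in_add c P :
  idempotent_elt c -> projective P -> generated_by c P -> in_add c P.
Proof.
move=> cc prP genP; pose F := pow_rmod 'I_(\dim {:P}) (reg_rmod L).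
have [g hg gE] : exists2 g : 'Hom(F, P), is_rhom g &
    g =1 fun x : {ffun 'I_(\dim {:P}) -> L} =>
      \sum_(i < \dim {:P}) ract (ract (vbasis {:P})`_i c) (x i).
  apply: rhom_exists => [a x y|x a].
    rewrite scaler_sumr -big_split; apply: eq_bigr => i _.
    by rewrite !ffunE ract_linr.
  by rewrite ract_suml; apply: eq_bigr => i _; rewrite ffunE /= ractA.
have sg : limg g = fullv.
  apply: genP => [|x]; first exact: limg_submod.
  pose y : {ffun 'I_(\dim {:P}) -> L} := [ffun i => coord (vbasis {:P}) i x *: 1].
  have -> : ract x c = g y.
    rewrite gE [in LHS](coord_vbasis (memvf x)) ract_suml.
    by apply: eq_bigr => i _; rewrite ffunE linearZ /= ract1 ractZl.
  exact/memv_img/memvf.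
have [s hs gs] := prP _ _ _ _ hg (@id_rhom _ _ P) sg.
have hc i : exists2 hi : 'Hom(P, reg_rmod L), is_rhom hi &
    hi =1 fun x => c * (s x : {ffun _ -> L}) i :> L.
  apply: rhom_exists => [a x y|x a].
    by rewrite linearP !ffunE mulrDr scalerAr.
  by rewrite hs ffunE /= mulrA.
have [h hh hE] := fin_all_exists2 hc.
exists 'I_(\dim {:P}), (fun i : 'I__ => ract (vbasis {:P})`_i c), h; split.
- exact: hh.
- by move=> i; rewrite -ractA cc.
- by move=> i x; rewrite hE mulrA cc.
move=> x; have := congr1 (fun u : 'Hom(P, P) => u x) gs.
rewrite comp_lfunE id_lfunE gE => {1}<-; apply: eq_bigr => i _.
by rewrite hE -!ractA mulrA cc.
Qed.

Lemma projective_in_add1 P : projective P -> in_add 1 P.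
Proof.
by move=> hP; apply: projective_in_add => //;
  [apply: mulr1 | apply: generated_by1].
Qed.

Lemma generated_by_img c M N (f : 'Hom(M, N)) :
  is_rhom f -> limg f = fullv -> generated_by c M -> generated_by c N.
Proof.
move=> hf sf gM U hU cU; have fU : (f @^-1: U)%VS = fullv.
  by apply: gM => [|x]; [apply: preim_submod | rewrite -memv_preim hf cU].
apply/eqP; rewrite eqEsubv subvf -sf; apply/subvP => _ /memv_imgP[x _ ->].
by rewrite memv_preim fU memvf.
Qed.

Lemma generated_by_hom_eq c M N (f g : 'Hom(M, N)) :
    generated_by c M -> is_rhom f -> is_rhom g ->
  (forall x, f (ract x c) = g (ract x c)) -> f = g.
Proof.
move=> gM hf hg fg; have K : lker (f - g) = fullv.
  by apply: gM => [|x]; [apply/lker_submod/sub_rhom | apply/eqlfunP].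
by apply/lfunP => x; apply/eqlfunP; rewrite K memvf.
Qed.

Lemma generated_by_zero c M :
  generated_by c M -> (forall x : M, ract x c = 0) -> rmod_zero M.
Proof.
move=> gM h; have U0 : (0%VS : {vspace M}) = fullv.
  by apply: gM => [x a|x]; rewrite ?h ?mem0v // !memv0 => /eqP ->; rewrite ract0l.
by move=> x; apply/eqP; rewrite -memv0 U0 memvf.
Qed.

Definition retract P Q : Prop := exists (i : 'Hom(P, Q)) (r : 'Hom(Q, P)),
  [/\ is_rhom i, is_rhom r & cancel i r].

Lemma retract_in_add c P Q : retract P Q -> in_add c Q -> in_add c P.
Proof.
move=> [i [r [hi hr ir]]] [I [p [h [hh pc ch ph]]]].
exists I, (fun j => r (p j)), (fun j => h j \o i)%VF; split.
- by move=> j; apply: comp_rhom.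
- by move=> j; rewrite -hr pc.
- by move=> j x; rewrite comp_lfunE ch.
move=> x; rewrite -{1}(ir x) (ph (i x)) raddf_sum /=; apply: eq_bigr => j _.
by rewrite hr comp_lfunE.
Qed.

Lemma retract_trans P Q M : retract P Q -> retract Q M -> retract P M.
Proof.
move=> [i [r [hi hr ir]]] [i' [r' [hi' hr' ir']]].
exists (i' \o i)%VF, (r \o r')%VF; split; try exact: comp_rhom.
by move=> x; rewrite !comp_lfunE ir' ir.
Qed.

Lemma iso_retract P Q : rmod_iso P Q -> retract P Q.
Proof. by move=> /rmod_isoP[f [g [hf hg fg _]]]; exists f, g. Qed.

Lemma iso_in_add c P Q : rmod_iso P Q -> in_add c Q -> in_add c P.
Proof. by move/iso_retract; apply: retract_in_add. Qed.

Lemma retract_generated_by c P Q :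
  retract P Q -> generated_by c Q -> generated_by c P.
Proof.
move=> [i [r [hi hr ir]]]; apply: generated_by_img hr _.
by apply/surj_lfunP => x; exists (i x).
Qed.

Section DirectSums.
Variables M N M' N' : rmodule L.
Let D := dsum_rmod M N.

Lemma dinl_exists : exists2 f : 'Hom(M, D), is_rhom f & f =1 (fun x => (x, 0)).
Proof.
apply: rhom_exists => [a x y|x a]; congr pair => //=; last by rewrite ract0l.
by rewrite scaler0 addr0.
Qed.

Lemma dinr_exists : exists2 f : 'Hom(N, D), is_rhom f & f =1 (fun x => (0, x)).
Proof.
apply: rhom_exists => [a x y|x a]; congr pair => //=; last by rewrite ract0l.
by rewrite scaler0 addr0.
Qed.

Lemma dfst_exists : exists2 f : 'Hom(D, M), is_rhom f & f =1 fst.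
Proof. exact: rhom_exists. Qed.

Lemma dsnd_exists : exists2 f : 'Hom(D, N), is_rhom f & f =1 snd.
Proof. exact: rhom_exists. Qed.

Lemma dmap_exists (f : 'Hom(M, M')) (g : 'Hom(N, N')) : is_rhom f -> is_rhom g ->
  exists2 u : 'Hom(D, dsum_rmod M' N'), is_rhom u &
    u =1 (fun x => (f x.1, g x.2)).
Proof.
move=> hf hg; apply: rhom_exists => [a x y|x a]; congr pair => /=;
  by rewrite ?linearP ?hf ?hg.
Qed.

Lemma retract_dsuml : retract M D.
Proof.
have [i hi iE] := dinl_exists; have [r hr rE] := dfst_exists.
by exists i, r; split=> // x; rewrite rE iE.
Qed.

Lemma retract_dsumr : retract N D.
Proof.
have [i hi iE] := dinr_exists; have [r hr rE] := dsnd_exists.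
by exists i, r; split=> // x; rewrite rE iE.
Qed.

Lemma dsum_in_add c : in_add c M -> in_add c N -> in_add c D.
Proof.
move=> [I [p [h [hh pc ch ph]]]] [I' [p' [h' [hh' pc' ch' ph']]]].
have [i hi iE] := dinl_exists; have [r hr rE] := dfst_exists.
have [i' hi' iE'] := dinr_exists; have [r' hr' rE'] := dsnd_exists.
exists (I + I')%type,
  (fun s => match s with inl j => i (p j) | inr j => i' (p' j) end),
  (fun s => match s with inl j => h j \o r | inr j => h' j \o r' end)%VF.
split.
- by case=> j; apply: comp_rhom.
- by case=> j; rewrite -?hi -?hi' ?pc ?pc'.
- by case=> j x; rewrite comp_lfunE ?ch ?ch'.
case=> x y; rewrite big_sumType; transitivity (i x + i' y).
  by rewrite iE iE'; congr pair; rewrite /= ?addr0 ?add0r.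
rewrite {1}(ph x) {1}(ph' y) !raddf_sum; congr (_ + _); apply: eq_bigr => j _.
  by apply: etrans (hi _ _) _; rewrite comp_lfunE rE.
by apply: etrans (hi' _ _) _; rewrite comp_lfunE rE'.
Qed.

Lemma dsum_iso : rmod_iso M M' -> rmod_iso N N' -> rmod_iso D (dsum_rmod M' N').
Proof.
move=> [f hf [f' fK f'K]] [g hg [g' gK g'K]].
have [u hu uE] := dmap_exists hf hg; exists u => //.
by exists (fun x => (f' x.1, g' x.2)) => [[x y]|[x y]]; rewrite uE /= ?fK ?gK ?f'K ?g'K.
Qed.
End DirectSums.

Lemma dsum_swap M N P : rmod_iso (dsum_rmod M (dsum_rmod N P))
                                 (dsum_rmod N (dsum_rmod M P)).
Proof.
have [u hu uE] : exists2 u : 'Hom(dsum_rmod M (dsum_rmod N P),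
    dsum_rmod N (dsum_rmod M P)), is_rhom u &
    u =1 fun x => (x.2.1, (x.1, x.2.2)) by apply: rhom_exists.
exists u => //; exists (fun x => (x.2.1, (x.1, x.2.2))).
  by move=> [x [y z]]; rewrite uE.
by move=> [x [y z]]; rewrite uE.
Qed.

Lemma zero_in_add c : in_add c (zero_rmod L).
Proof.
exists 'I_0, (fun _ => 0), (fun _ => 0); split; try by case.
by move=> x; rewrite big_ord0 [LHS]thinmx0.
Qed.

End Projectives.

(** * Presentations and tau-rigidity *)

Section Presentations.
Variables (k : fieldType) (L : falgType k).
Implicit Types (M N P Q : rmodule L) (c : L).

Definition presentation Q1 Q0 N (f : 'Hom(Q1, Q0)) (p : 'Hom(Q0, N)) : Prop :=
  [/\ is_rhom f, is_rhom p, limg p = fullv & limg f = lker p].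

Definition presented_by c N : Prop :=
  exists Q1 Q0 (f : 'Hom(Q1, Q0)) (p : 'Hom(Q0, N)),
    [/\ in_add c Q1, in_add c Q0 & presentation f p].

Lemma presentation0 Q1 Q0 N (f : 'Hom(Q1, Q0)) (p : 'Hom(Q0, N)) x :
  presentation f p -> p (f x) = 0.
Proof.
case=> _ _ _ fp; apply/eqP; rewrite -memv_ker -fp; exact/memv_img/memvf.
Qed.

Lemma presented_generated c N : presented_by c N -> generated_by c N.
Proof.
move=> [Q1 [Q0 [f [p [_ /in_add_generated g0 [_ hp sp _]]]]]].
exact: generated_by_img hp sp g0.
Qed.

Lemma in_add_presented c P : in_add c P -> presented_by c P.
Proof.
move=> hP; exists (zero_rmod L), P, 0, \1%VF; split=> //.
  exact: zero_in_add.
split; [exact: zero_rhom | exact: id_rhom | |].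
  by apply/surj_lfunP => x; exists x; rewrite id_lfunE.
apply/vspaceP => x; rewrite memv_ker id_lfunE.
by apply/memv_imgP/eqP => [[y _ ->]|->]; [|exists 0; rewrite ?memvf //];
  rewrite zero_lfunE.
Qed.

Lemma iso_presented c M N : rmod_iso M N -> presented_by c M -> presented_by c N.
Proof.
move=> /rmod_isoP[u [v [hu hv uK vK]]] [Q1 [Q0 [f [p [h1 h0 [hf hp sp fp]]]]]].
exists Q1, Q0, f, (u \o p)%VF; split=> //; split=> //; first exact: comp_rhom.
  apply/surj_lfunP => y; have /surj_lfunP/(_ (v y))[x px] := sp.
  by exists x; rewrite comp_lfunE px vK.
rewrite fp; apply/vspaceP => x; rewrite !memv_ker comp_lfunE.
by apply/eqP/eqP => [->|/(congr1 v)]; rewrite ?uK linear0.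
Qed.

Lemma dsum_presented c M N :
  presented_by c M -> presented_by c N -> presented_by c (dsum_rmod M N).
Proof.
move=> [Q1 [Q0 [f [p [h1 h0 [hf hp sp fp]]]]]].
move=> [Q1' [Q0' [f' [p' [h1' h0' [hf' hp' sp' fp']]]]]].
have [F hF FE] := dmap_exists hf hf'; have [p2 hp2 pE] := dmap_exists hp hp'.
exists (dsum_rmod Q1 Q1'), (dsum_rmod Q0 Q0'), F, p2.
split; try exact: dsum_in_add.
split=> //.
  apply/surj_lfunP => -[y y']; have /surj_lfunP/(_ y)[x <-] := sp.
  by have /surj_lfunP/(_ y')[x' <-] := sp'; exists (x, x'); rewrite pE.
apply/vspaceP => -[x x']; rewrite memv_ker pE /=.
apply/memv_imgP/eqP => [[[y y'] _]|[px px']].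
  rewrite FE => -[-> ->]; congr pair; apply/eqP; rewrite -memv_ker.
    by rewrite -fp memv_img ?memvf.
  by rewrite -fp' memv_img ?memvf.
have : x \in lker p by rewrite memv_ker px.
rewrite -fp => /memv_imgP[y _ ->].
have : x' \in lker p' by rewrite memv_ker px'.
rewrite -fp' => /memv_imgP[y' _ ->].
by exists (y, y'); rewrite ?memvf // FE.
Qed.

(** The hypothesis says that the image of [u] and ker p together span [P]. *)
Lemma superfluous_surj P M (p : 'Hom(P, M)) Q (u : 'Hom(Q, P)) :
    is_rhom u -> superfluous (lker p) ->
    (forall x, exists y, p (u y) = p x) -> limg u = fullv.
Proof.
move=> hu sK h; apply: sK; first exact: limg_submod.
apply/vspaceP => x; rewrite memvf; have [y uy] := h x.
rewrite -(subrKC (u y) x) memv_add ?memv_img ?memvf //.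
by rewrite memv_ker linearB /= uy subrr.
Qed.

Lemma min_presentation_in_add c P1 P0 N (f : 'Hom(P1, P0)) (p : 'Hom(P0, N)) :
    idempotent_elt c -> presented_by c N -> min_proj_presentation f p ->
  in_add c P1 /\ in_add c P0.
Proof.
move=> cc [Q1 [Q0 [g [q [h1 h0 [hg hq sq gq]]]]]].
case=> [[prP0 hp sp] limp [prP1 hf sf] fp].
have [|u hu uE] := in_add_lift h0 hp hq; first by rewrite limp subvf.
have su : limg u = fullv.
  apply: superfluous_surj hu sp _ => x.
  by have /surj_lfunP/(_ (p x))[y <-] := sq; exists y.
have hP0 : in_add c P0.
  apply: projective_in_add => //.
  exact/(generated_by_img hu su)/(in_add_generated h0).
have qg x : q (g x) = 0.
  by apply/eqP; rewrite -memv_ker -gq memv_img ?memvf.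
have [|v hv vE] := in_add_lift h1 hf (comp_rhom hu hg).
  rewrite fp; apply/subvP => _ /memv_imgP[x _ ->].
  by rewrite memv_ker comp_lfunE uE qg.
split=> //; apply: projective_in_add => //.
apply: (generated_by_img hv _ (in_add_generated h1)).
apply: superfluous_surj hv sf _ => x.
have /surj_lfunP/(_ (f x))[y uy] := su.
have : y \in lker q.
  by rewrite memv_ker -uE uy -memv_ker -fp memv_img ?memvf.
rewrite -gq => /memv_imgP[z _ yz]; exists z.
by rewrite vE comp_lfunE -yz uy.
Qed.

End Presentations.

(** * The transpose, its dual, and tau-rigidity as a factorization property *)

Section TauRigid.
Variables (k : fieldType) (L : falgType k).
Implicit Types (M N P Q : rmodule L) (S T : lmodule L).

Lemma lactBl S (x y : S) a : lact a (x - y) = lact a x - lact a y.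
Proof. exact: (raddfB (lact a)). Qed.

Lemma quotient_lmod S (U : {vspace S}) :
    (forall x a, x \in U -> lact a x \in U) ->
  exists T (q : 'Hom(S, T)),
    [/\ is_lhom q, limg q = fullv & forall x, q x = 0 <-> x \in U].
Proof.
move=> hU; have [W [p [s [sK pU]]]] := quotient_vspace U.
have pa x a : p (lact a (s (p x))) = p (lact a x).
  apply/eqP; rewrite -subr_eq0 -raddfB; apply/eqP/pU.
  by rewrite -lactBl; apply/hU/pU; rewrite linearB /= sK subrr.
have actl a : linear (fun w => p (lact a (s w))).
  by move=> c x y; rewrite linearP lact_linl linearP.
have actr w : linear (fun a => p (lact a (s w))).
  by move=> c x y; rewrite lact_linr linearP.
have act1 w : p (lact 1 (s w)) = w by rewrite lact1 sK.
have actA a b w : p (lact (a * b) (s w)) = p (lact a (s (p (lact b (s w))))).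
  by rewrite pa lactA.
exists (LModule actl actr act1 actA), p; split=> //.
- by move=> a x; rewrite /= pa.
- by apply/surj_lfunP => w; exists (s w).
Qed.

Definition factors_through P1 P0 (f : 'Hom(P1, P0)) N : Prop :=
  forall g : 'Hom(P1, N), is_rhom g ->
    exists2 h : 'Hom(P0, N), is_rhom h & forall x, g x = h (f x).

Lemma vsprojK_ldual P (h : 'Hom(P, reg_rmod L)) : is_rhom h ->
  vsval (vsproj (homv P (reg_rmod L)) h) = h.
Proof. by move=> hh; rewrite vsprojK //; apply/homvP. Qed.

Lemma ldual_rhom P (h : ldual P) : is_rhom (vsval h).
Proof. exact/homvP/subvsP. Qed.

Lemma transpose_exists P1 P0 (f : 'Hom(P1, P0)) : is_rhom f ->
  exists T, is_transpose f T.
Proof.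
move=> hf; pose C (h : ldual P0) : ldual P1 :=
  vsproj (homv P1 (reg_rmod L)) (vsval h \o f)%VF.
have [F FE] : exists F : 'Hom(ldual P0, ldual P1), F =1 C.
  apply: linear_lfun => a g h; rewrite /C linearP /= comp_lfunDl -comp_lfunZl.
  by rewrite linearP.
have CK (g : ldual P0) : vsval (F g) = (vsval g \o f)%VF.
  by rewrite FE vsprojK_ldual //; apply: comp_rhom => //; apply: ldual_rhom.
have FU x a : x \in limg F -> lact a x \in limg F.
  move=> /memv_imgP[g _ ->]; apply/memv_imgP; exists (lact a g); rewrite ?memvf //.
  apply/subvs_inj/lfunP => y; rewrite CK comp_lfunE.
  by rewrite [LHS]ldual_actE CK comp_lfunE [RHS]ldual_actE.
have [T [q [hq sq qU]]] := quotient_lmod FU; exists T, q; split=> // h.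
split=> [/qU/memv_imgP[g _ ->]|[g hg]]; first by exists g; rewrite CK.
by apply/qU/memv_imgP; exists g; rewrite ?memvf //; apply: subvs_inj; rewrite CK.
Qed.

(* A balanced form on [N] and [ldual P1] is the same as a functional on
   Hom(P1, N), by dual bases; so [D] of the transpose of [f] receives no map from
   [N] iff no functional on Hom(P1, N) kills the maps through [f]. *)
Lemma hom_zero_kdualP P1 P0 (f : 'Hom(P1, P0)) T N :
    projective P1 -> projective P0 -> is_rhom f -> is_transpose f T ->
  hom_zero N (kdual T) <-> factors_through f N.
Proof.
move=> /projective_in_add1[I [p [h hP1]]] /projective_in_add1[I' [p' [h' hP0]]].
move=> hf [q [hq sq qE]]; have [hh _ _ _] := hP1; have [hh' _ _ _] := hP0.
split=> [N0 g hg|fN theta hth].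
  (* Composition with [f] as a linear map: if g is not in its image on the equivariant maps, a
     functional [lam] separates g from that image. *)
  have [F FE] : exists F : 'Hom('Hom(P0, N), 'Hom(P1, N)), F =1 (fun u => u \o f)%VF.
    by apply: linear_lfun => a u v; rewrite comp_lfunDl -comp_lfunZl.
  have [/memv_imgP[u uH gu]|gF] := boolP (g \in (F @: homv P0 N)%VS).
    exists u => [|x]; first exact/homvP.
    by rewrite gu FE comp_lfunE.
  have [lam lam0 lamg] := lfun_separate gF.
  have lamF u : is_rhom u -> lam (u \o f)%VF = 0.
    by move=> hu; apply: lam0; rewrite -FE memv_img //; apply/homvP.
  have qV t : q (q^-1%VF t) = t by rewrite limg_lfunVK // sq memvf.
  have RH_lin m : linear (fun u : ldual P1 => ract_hom m (vsval u) : 'Hom(P1, N)).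
    move=> a u v; apply/lfunP => x.
    rewrite add_lfunE scale_lfunE !ract_homE linearP /= add_lfunE scale_lfunE.
    by rewrite ract_linr.
  (* If q s = q t, then s - t = g0 o f, so m (s - t) = (m g0) o f is a map through [f], where [lam]
     vanishes. Thus lam (m s) depends only on m and q s. *)
  have lamK m (s t : ldual P1) : q s = q t ->
      lam (ract_hom m (vsval s)) = lam (ract_hom m (vsval t)).
    move=> st; have : q (s - t) = 0 by rewrite linearB /= st subrr.
    move/qE => [g0 g0E]; apply/eqP; rewrite -subr_eq0 -linearB /=.
    have -> : ract_hom m (vsval s) - ract_hom m (vsval t)
              = (ract_hom m (vsval g0) \o f)%VF.
      apply/lfunP => x; rewrite add_lfunE opp_lfunE comp_lfunE !ract_homE.
      rewrite -raddfB /=; congr (ract m _).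
      have := congr1 (fun u : 'Hom(_, _) => u x) g0E.
      by rewrite comp_lfunE => <-; rewrite linearB /= add_lfunE opp_lfunE.
    by rewrite lamF //; apply/ract_hom_rhom/ldual_rhom.
  (* The balanced form (m, q s) |-> lam (m s), read as a map from [N] to the dual of [T]. *)
  pose th m : 'Hom(T, k^o) :=
    (lam \o linfun (fun u : ldual P1 => ract_hom m (vsval u) : 'Hom(P1, N))
         \o q^-1)%VF.
  have thE m t : th m t = lam (ract_hom m (vsval (q^-1%VF t))).
    by rewrite /th !comp_lfunE (linear_linfunE (RH_lin m)).
  have [theta hth thetaE] : exists2 theta : 'Hom(N, kdual T), is_rhom theta
      & theta =1 th.
    apply: rhom_exists => [a x y|x a]; apply/lfunP => t.
      rewrite add_lfunE scale_lfunE !thE -linearP; congr (lam _).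
      apply/lfunP => z; rewrite add_lfunE scale_lfunE !ract_homE.
      by rewrite ract_linl.
    rewrite [RHS]kdual_actE !thE.
    rewrite [RHS](lamK _ _ (lact a (q^-1%VF t))); last by rewrite hq !qV.
    congr (lam _); apply/lfunP => z.
    by rewrite !ract_homE ldual_actE ractA.
  (* This map is zero by hypothesis, so [lam] kills every rank-one map, hence also g, a sum of
     rank-one maps. *)
  have lam_ract m (h0 : 'Hom(P1, reg_rmod L)) : is_rhom h0 ->
      lam (ract_hom m h0) = 0.
    move=> hh0; have := thetaE m; rewrite (N0 _ hth) zero_lfunE.
    move/(congr1 (fun u : 'Hom(T, k^o) => u (q (vsproj (homv P1 (reg_rmod L)) h0)))).
    rewrite zero_lfunE thE (lamK _ _ (vsproj _ h0)) ?qV //.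
    by rewrite vsprojK_ldual.
  case/eqP: lamg; have -> : g = \sum_i ract_hom (g (p i)) (h i).
    apply/lfunP => x; rewrite (dual_basis_hom hP1 hg) sum_lfunE.
    by apply: eq_bigr => i _; rewrite ract_homE.
  by rewrite raddf_sum big1 // => i _; apply: lam_ract.
pose dl i : ldual P1 := vsproj (homv P1 (reg_rmod L)) (h i).
have dlK i : vsval (dl i) = h i by apply: vsprojK_ldual.
(* The functional on Hom(P1, N) that belongs to [theta]: by [thq] its value at the rank-one map m u
   is theta m (q u). *)
pose Lam (g : 'Hom(P1, N)) : k^o :=
  \sum_i (theta (g (p i)) : 'Hom(T, k^o)) (q (dl i)).
have actE m a t : (theta (ract m a) : 'Hom(T, k^o)) t = (theta m : 'Hom(T, k^o)) (lact a t).
  by rewrite hth [LHS]kdual_actE.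
have thq m (u : ldual P1) :
    (theta m : 'Hom(T, k^o)) (q u) = Lam (ract_hom m (vsval u)).
  have uE : u = \sum_i lact (vsval u (p i) : L) (dl i).
    apply/subvs_inj/lfunP => x; rewrite raddf_sum sum_lfunE /=.
    rewrite (dual_basis_hom hP1 (ldual_rhom u)); apply: eq_bigr => i _.
    by rewrite [RHS]ldual_actE dlK.
  have -> : q u = \sum_i lact (vsval u (p i) : L) (q (dl i)).
    by rewrite {1}uE raddf_sum; apply: eq_bigr => i _; rewrite /= hq.
  rewrite raddf_sum; apply: eq_bigr => i _ /=.
  by rewrite -actE ract_homE.
apply/lfunP => m; apply/lfunP => t; rewrite !zero_lfunE.
have /surj_lfunP/(_ t)[u <-] := sq; rewrite thq.
have [|g0 hg0 g0E] := fN (ract_hom m (vsval u)).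
  exact/ract_hom_rhom/ldual_rhom.
(* The map m u equals g0 o f. Expanding g0 in the dual basis of [P0] collects the terms into values
   of [theta] at q (h'_j o f), which is zero in the cokernel. *)
rewrite /Lam; under eq_bigr do rewrite g0E (dual_basis_hom hP0 hg0) raddf_sum
  /= sum_lfunE.
rewrite exchange_big big1 //= => j _.
under eq_bigr do rewrite actE.
rewrite -raddf_sum /=.
have h'f : is_rhom (h' j \o f)%VF by apply: comp_rhom.
have -> : \sum_i lact (h' j (f (p i)) : L) (q (dl i)) =
    q (vsproj (homv P1 (reg_rmod L)) (h' j \o f)%VF).
  under eq_bigr do rewrite -hq.
  rewrite -raddf_sum /=; congr (q _).
  apply/subvs_inj/lfunP => x; rewrite raddf_sum sum_lfunE /= vsprojK_ldual //.
  rewrite (dual_basis_hom hP1 h'f); apply: eq_bigr => i _.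
  by rewrite [LHS]ldual_actE dlK comp_lfunE.
suff -> : q (vsproj (homv P1 (reg_rmod L)) (h' j \o f)%VF) = 0 by rewrite linear0.
apply/qE; exists (vsproj (homv P0 (reg_rmod L)) (h' j)).
by rewrite !vsprojK_ldual.
Qed.

Lemma rmod_iso_kdual_zero M N T : rmod_iso N (kdual T) ->
  hom_zero M N <-> hom_zero M (kdual T).
Proof.
move=> /rmod_isoP[u [v [hu hv uK vK]]]; split=> h f hf; apply/lfunP => x.
  have /lfunP/(_ x) := h _ (comp_rhom hv hf); rewrite comp_lfunE zero_lfunE => vf0.
  by rewrite zero_lfunE -(vK (f x)) vf0 linear0.
have /lfunP/(_ x) := h _ (comp_rhom hu hf); rewrite comp_lfunE zero_lfunE => uf0.
by rewrite zero_lfunE -(uK (f x)) uf0 linear0.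
Qed.

(** Eliminates the translate. The existential over minimal presentations is inherited from
    [tau_rigid]; for the converse, the cokernel [T] is built from the given [f]. *)
Lemma tau_rigidP M : tau_rigid M <->
  exists P1 P0 (f : 'Hom(P1, P0)) (p : 'Hom(P0, M)),
    min_proj_presentation f p /\ factors_through f M.
Proof.
split=> [[N [P1 [P0 [f [p [T [fp fT iN]]]]]] hMN]|[P1 [P0 [f [p [fp fM]]]]]].
  exists P1, P0, f, p; split=> //.
  have [[prP0 _ _] _ [prP1 hf _] _] := fp.
  exact/(hom_zero_kdualP _ prP1 prP0 hf fT)/(rmod_iso_kdual_zero _ iN).
have [[prP0 _ _] _ [prP1 hf _] _] := fp.
have [T fT] := transpose_exists hf; exists (kdual T).
  exists P1, P0, f, p, T; split=> //; exact: rmod_iso_refl.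
exact/(hom_zero_kdualP _ prP1 prP0 hf fT).
Qed.

Lemma min_presentation_iso P1 P0 M N (f : 'Hom(P1, P0)) (p : 'Hom(P0, M))
    (u : 'Hom(M, N)) : is_rhom u -> bijective u ->
  min_proj_presentation f p -> min_proj_presentation f (u \o p)%VF.
Proof.
move=> hu [v uK vK] [[prP0 hp sp] limp [prP1 hf sf] fp].
have kup : lker (u \o p)%VF = lker p.
  apply/vspaceP => x; rewrite !memv_ker comp_lfunE.
  apply/eqP/eqP => [upx|->]; last by rewrite linear0.
  by apply: (can_inj uK); rewrite upx linear0.
split; rewrite ?kup //; last first.
  apply/surj_lfunP => y; have /surj_lfunP/(_ (v y))[x px] := limp.
  by exists x; rewrite comp_lfunE px vK.
by split; rewrite ?kup //; apply: comp_rhom.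
Qed.

Lemma iso_tau_rigid M N : rmod_iso M N -> tau_rigid M -> tau_rigid N.
Proof.
move=> iMN /tau_rigidP[P1 [P0 [f [p [fp fM]]]]]; apply/tau_rigidP.
have [u hu bu] := iMN; exists P1, P0, f, (u \o p)%VF; split.
  exact: min_presentation_iso.
have /rmod_isoP[w [v [hw hv wK vK]]] := iMN => g hg.
have [h hh hE] := fM _ (comp_rhom hv hg); exists (w \o h)%VF.
  exact: comp_rhom.
by move=> x; rewrite comp_lfunE -hE comp_lfunE vK.
Qed.

End TauRigid.

(** * Restriction to the corner algebra *)

Section Restriction.
Variables (k : fieldType) (L : falgType k) (c : L).
Hypotheses (cc : idempotent_elt c) (c0 : c != 0).
Implicit Types (M N P Q : rmodule L).
Let G : falgType k := subvs_of (corner cc c0).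

Lemma corner_mull (a : G) : c * vsval a = vsval a.
Proof. by have /(corner_vspaceP _ cc)[] := subvsP a. Qed.

Lemma corner_mulr (a : G) : vsval a * c = vsval a.
Proof. by have /(corner_vspaceP _ cc)[] := subvsP a. Qed.

Lemma corner_val1 : vsval (1 : G) = c.
Proof. exact: algid_corner. Qed.

Lemma corner_projK a : c * a = a -> a * c = a ->
  vsval (vsproj (corner cc c0) a) = a.
Proof. by move=> ca ac; rewrite vsprojK //; apply/corner_vspaceP. Qed.

Definition res_space N : {vspace N} := limg (ractf N c).

Lemma res_spaceP N (x : N) : reflect (ract x c = x) (x \in res_space N).
Proof.
apply: (iffP memv_imgP) => [[y _ ->]|xc].
  by rewrite !ractfE -ractA cc.
by exists x; rewrite ?memvf // ractfE.
Qed.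

Section Module.
Variable N : rmodule L.
Definition res_act (x : subvs_of (res_space N)) (a : G) :
  subvs_of (res_space N) := vsproj (res_space N) (ract (vsval x) (vsval a)).
Lemma res_act_val x a : vsval (res_act x a) = ract (vsval x) (vsval a).
Proof. by rewrite vsprojK //; apply/res_spaceP; rewrite -ractA corner_mulr. Qed.
Fact res_act_linl a : linear (fun x => res_act x a).
Proof. by move=> b x y; rewrite /res_act linearP /= ract_linl linearP. Qed.
Fact res_act_linr x : linear (res_act x).
Proof. by move=> b u v; rewrite /res_act !linearP. Qed.
Fact res_act1 x : res_act x 1 = x.
Proof.
apply: subvs_inj; rewrite res_act_val corner_val1.
exact/res_spaceP/subvsP.
Qed.
Fact res_actA x a b : res_act x (a * b) = res_act (res_act x a) b.
Proof. by apply: subvs_inj; rewrite !res_act_val -ractA. Qed.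
Definition res_rmod : rmodule G :=
  RModule res_act_linl res_act_linr res_act1 res_actA.
End Module.

Lemma res_actE N (x : res_rmod N) (a : G) :
  vsval (ract x a) = ract (vsval x) (vsval a).
Proof. exact: res_act_val. Qed.

Lemma res_valc N (x : res_rmod N) : ract (vsval x) c = vsval x.
Proof. exact/res_spaceP/subvsP. Qed.

Lemma res_lift N (y : N) : ract y c = y -> exists x : res_rmod N, vsval x = y.
Proof.
by move=> yc; exists (vsproj (res_space N) y); apply/vsprojK/res_spaceP.
Qed.

Lemma res_liftc N (y : N) : exists x : res_rmod N, vsval x = ract y c.
Proof. by apply: res_lift; rewrite -ractA cc. Qed.

Lemma generated_by_res N (U : {vspace N}) : generated_by c N -> is_submod U ->
  (forall x : res_rmod N, vsval x \in U) -> U = fullv.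
Proof. by move=> gN hU h; apply: gN => // x; have [y <-] := res_liftc x. Qed.

Lemma generated_by_res_eq M N (f g : 'Hom(M, N)) :
    generated_by c M -> is_rhom f -> is_rhom g ->
  (forall x : res_rmod M, f (vsval x) = g (vsval x)) -> f =1 g.
Proof.
move=> gM hf hg fg x; congr (fun_of_lfun _ x).
apply: (generated_by_hom_eq gM hf hg) => y.
by have [z <-] := res_liftc y.
Qed.

Definition extends M N (f : 'Hom(M, N)) (phi : 'Hom(res_rmod M, res_rmod N)) :=
  forall x, f (vsval x) = vsval (phi x).

Lemma res_hom M N (f : 'Hom(M, N)) : is_rhom f ->
  exists2 phi, is_rhom phi & extends f phi.
Proof.
move=> hf; pose r (x : res_rmod M) : res_rmod N :=
  vsproj (res_space N) (f (vsval x)).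
have rK x : vsval (r x) = f (vsval x).
  by rewrite vsprojK //; apply/res_spaceP; rewrite -hf res_valc.
have [phi hphi phiE] : exists2 phi : 'Hom(res_rmod M, res_rmod N),
    is_rhom phi & phi =1 r.
  apply: rhom_exists => [a x y|x a].
    by rewrite /r !linearP.
  by apply: subvs_inj; rewrite rK res_actE hf -rK -res_actE.
by exists phi => // x; rewrite phiE rK.
Qed.

(** The p_i lie in Qc, so f(x) can be the sum of the phi(p_i) h_i(x). For x in Qc the coefficients
    h_i(x) = c h_i(x) c lie in [G], and G-linearity of [phi] gives agreement. *)
Lemma in_add_extend Q N (phi : 'Hom(res_rmod Q, res_rmod N)) :
  in_add c Q -> is_rhom phi -> exists2 f, is_rhom f & extends f phi.
Proof.
move=> [I [p [h [hh pc ch ph]]]] hphi.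
have [q qE] := fin_all_exists (fun i => res_lift (pc i)).
exists (\sum_i ract_hom (vsval (phi (q i))) (h i)).
  by apply: sum_rhom => i; apply: ract_hom_rhom.
move=> x; pose a i : G := vsproj (corner cc c0) (h i (vsval x)).
have aE i : vsval (a i) = h i (vsval x).
  by rewrite corner_projK ?ch // -[RHS](congr1 (h i) (res_valc x)) hh.
have xE : x = \sum_i ract (q i) (a i).
  apply: subvs_inj; rewrite [LHS]ph raddf_sum; apply: eq_bigr => i _ /=.
  by rewrite res_actE qE aE.
rewrite {2}xE sum_lfunE !raddf_sum; apply: eq_bigr => i _ /=.
by rewrite ract_homE hphi res_actE aE.
Qed.

(** Restriction is full: the composite of [phi] with the restricted cover of [M] extends to [F] on
    Q0. The map F o d vanishes on Q1 c, hence on Q1, so [F] descends to the cokernel [M] of d. *)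
Lemma presented_extend M N (phi : 'Hom(res_rmod M, res_rmod N)) :
  presented_by c M -> is_rhom phi -> exists2 f, is_rhom f & extends f phi.
Proof.
move=> [Q1 [Q0 [d [p [h1 h0 pres]]]]] hphi; have [hd hp sp dp] := pres.
have [P hP PE] := res_hom hp.
have [F hF FE] := in_add_extend h0 (comp_rhom hphi hP).
have [|f hf fE] := rhom_factor hp hF sp.
  rewrite -dp; apply/subvP => _ /memv_imgP[x _ ->]; rewrite memv_ker.
  rewrite -comp_lfunE; apply/eqP; rewrite -[RHS](zero_lfunE _ x).
  apply: (generated_by_res_eq (in_add_generated h1)) => [||y].
  - exact: comp_rhom.
  - exact: zero_rhom.
  have [D hD DE] := res_hom hd.
  rewrite comp_lfunE DE FE comp_lfunE zero_lfunE.
  have -> : P (D y) = 0.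
    by apply: subvs_inj; rewrite -PE -DE (presentation0 _ pres).
  by rewrite !linear0.
(* Since x = xc, a preimage y of x may be replaced by yc, which lies in Q0 c. *)
exists f => // x; have /surj_lfunP/(_ (vsval x))[y yx] := sp.
have [z zE] := res_liftc y.
have pz : p (vsval z) = vsval x by rewrite zE hp yx res_valc.
rewrite -pz fE FE comp_lfunE; congr (vsval (phi _)).
by apply: subvs_inj; rewrite -PE.
Qed.

Lemma res_iso M N : rmod_iso M N -> rmod_iso (res_rmod M) (res_rmod N).
Proof.
move=> /rmod_isoP[f [g [hf hg fK gK]]]; apply/rmod_isoP.
have [F hF FE] := res_hom hf; have [H hH HE] := res_hom hg.
by exists F, H; split=> // x; apply: subvs_inj; rewrite -?FE -?HE -?FE ?fK ?gK.
Qed.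

(** Extensions of mutually inverse maps compose to endomorphisms that agree with the identity on Mc
    and on Nc, hence everywhere. *)
Lemma presented_iso M N : presented_by c M -> presented_by c N ->
  rmod_iso (res_rmod M) (res_rmod N) -> rmod_iso M N.
Proof.
move=> pM pN /rmod_isoP[F [H [hF hH FK HK]]]; apply/rmod_isoP.
have [f hf fE] := presented_extend pM hF.
have [g hg gE] := presented_extend pN hH.
exists f, g; split=> // x.
  rewrite -comp_lfunE -[RHS](id_lfunE x).
  apply: (generated_by_res_eq (presented_generated pM)) => [||y].
  - exact: comp_rhom.
  - exact: id_rhom.
  by rewrite comp_lfunE fE gE FK id_lfunE.
rewrite -comp_lfunE -[RHS](id_lfunE x).
apply: (generated_by_res_eq (presented_generated pN)) => [||y].
- exact: comp_rhom.
- exact: id_rhom.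
by rewrite comp_lfunE gE fE HK id_lfunE.
Qed.

Lemma res_dsum M N : rmod_iso (res_rmod (dsum_rmod M N))
                              (dsum_rmod (res_rmod M) (res_rmod N)).
Proof.
have [i hi iE] := dinl_exists M N; have [r hr rE] := dfst_exists M N.
have [i' hi' iE'] := dinr_exists M N; have [r' hr' rE'] := dsnd_exists M N.
have [I hI IE] := res_hom hi; have [R hR RE] := res_hom hr.
have [I' hI' IE'] := res_hom hi'; have [R' hR' RE'] := res_hom hr'.
have [F hF FE] : exists2 F : 'Hom(res_rmod (dsum_rmod M N),
      dsum_rmod (res_rmod M) (res_rmod N)), is_rhom F &
    F =1 fun x => (R x, R' x).
  apply: rhom_exists => [a x y|x a]; congr pair; by rewrite /= ?linearP ?hR ?hR'.
exists F => //; exists (fun x => I x.1 + I' x.2) => [x|[x y]]; rewrite FE /=.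
  apply: subvs_inj; rewrite linearD /= -IE -IE' -RE -RE' rE rE' iE iE'.
  by case: (vsval x) => u v; congr pair; rewrite /= ?addr0 ?add0r.
congr pair; apply: subvs_inj; rewrite -?RE -?RE' ?rE ?rE' linearD /= -IE -IE'.
  by rewrite iE iE' /= addr0.
by rewrite iE iE' /= add0r.
Qed.

Lemma zero_iso (A : falgType k) (X Y : rmodule A) :
  rmod_zero X -> rmod_zero Y -> rmod_iso X Y.
Proof.
move=> X0 Y0; exists 0; first exact: zero_rhom.
by exists (fun _ => 0) => x; rewrite ?(X0 x) ?(Y0 x) ?zero_lfunE.
Qed.

Lemma zero_rmod_zero (A : falgType k) : rmod_zero (zero_rmod A).
Proof. by move=> x; rewrite [LHS]thinmx0. Qed.

Lemma res_zero M : rmod_zero M -> rmod_zero (res_rmod M).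
Proof. by move=> M0 x; apply: subvs_inj; rewrite (M0 (vsval x)) linear0. Qed.

Lemma generated_res_zero M :
  generated_by c M -> rmod_zero (res_rmod M) -> rmod_zero M.
Proof.
move=> gM M0; apply: (generated_by_zero gM) => x.
by have [y <-] := res_liftc x; rewrite (M0 y) linear0.
Qed.

(** A dual basis restricts: the p_i already lie in Pc, and the h_i send Pc into cLc. The idempotent
    c becomes the unit of [G]. *)
Lemma res_in_add P : in_add c P -> in_add 1 (res_rmod P).
Proof.
move=> [I [p [h [hh pc ch ph]]]].
have [q qE] := fin_all_exists (fun i => res_lift (pc i)).
pose a i (x : res_rmod P) : G := vsproj (corner cc c0) (h i (vsval x)).
have aE i x : vsval (a i x) = h i (vsval x).
  by rewrite corner_projK ?ch // -[RHS](congr1 (h i) (res_valc x)) hh.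
have ha i : exists2 g : 'Hom(res_rmod P, reg_rmod G), is_rhom g & g =1 a i.
  apply: rhom_exists => [b x y|x b]; first by rewrite /a !linearP.
  by apply: subvs_inj; rewrite aE res_actE hh -aE.
have [g hg gE] := fin_all_exists2 ha; exists I, q, g; split=> //.
- by move=> i; rewrite ract1.
- by move=> i x; rewrite mul1r.
move=> x; apply: subvs_inj; rewrite [LHS]ph raddf_sum; apply: eq_bigr => i _ /=.
by rewrite res_actE qE gE aE.
Qed.
End Restriction.

(** * Induction from the corner algebra *)

Section Induction.
Variables (k : fieldType) (L : falgType k) (c : L).
Hypotheses (cc : idempotent_elt c) (c0 : c != 0).
Implicit Types (M N P Q : rmodule L).
Let G : falgType k := subvs_of (corner cc c0).
Local Notation res := (res_rmod cc c0).

(** A dual basis of Pc over [G] is extended to [P]. Each functional Pc -> cLc is viewed as a map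
    into Lc, the restriction of the regular module, and so extends to P -> L. The dual basis
    identities hold on Pc and therefore on [P]. *)
Lemma in_add_res P : presented_by c P -> projective (res P) -> in_add c P.
Proof.
move=> pP /projective_in_add1[I [p [h [hh _ _ ph]]]].
have hE i : exists2 H : 'Hom(P, reg_rmod L), is_rhom H &
    forall x : res P, H (vsval x) = vsval (h i x : G).
  have [g hg gE] : exists2 g : 'Hom(res P, res (reg_rmod L)), is_rhom g &
      forall x, vsval (g x) = vsval (h i x : G).
    pose r x : res (reg_rmod L) :=
      vsproj (res_space c (reg_rmod L)) (vsval (h i x : G)).
    have rK x : vsval (r x) = vsval (h i x : G).
      rewrite vsprojK //; apply/res_spaceP => //; exact: corner_mulr.
    have [g hg gE] : exists2 g : 'Hom(res P, res (reg_rmod L)), is_rhom g &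
        g =1 r.
      apply: rhom_exists => [a x y|x a]; first by rewrite /r !linearP.
      by apply: subvs_inj; rewrite rK hh res_actE rK.
    by exists g => // x; rewrite gE rK.
  have [H hH HE] := presented_extend pP hg.
  by exists H => // x; rewrite HE gE.
have [H hH HE] := fin_all_exists2 hE.
exists I, (fun i => vsval (p i)), H; split=> //.
- by move=> i; apply: res_valc.
- move=> i; have [H' hH' H'E] : exists2 H' : 'Hom(P, reg_rmod L), is_rhom H' &
      H' =1 fun x => c * (H i x : L).
    apply: rhom_exists => [a x y|x a]; first by rewrite linearP mulrDr scalerAr.
    by rewrite hH /= mulrA.
  have HH : H' =1 H i.
    apply: (generated_by_res_eq (presented_generated pP)) => // y.
    by rewrite H'E HE corner_mull.
  by move=> x; rewrite -H'E HH.
have sumE : \1%VF =1 \sum_i ract_hom (vsval (p i)) (H i).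
  apply: (generated_by_res_eq (presented_generated pP)).
  - exact: id_rhom.
  - by apply: sum_rhom => i; apply: ract_hom_rhom.
  move=> y; rewrite id_lfunE sum_lfunE {1}[y]ph raddf_sum.
  by apply: eq_bigr => i _; rewrite /= res_actE ract_homE HE.
move=> x; rewrite -[LHS](id_lfunE x) sumE sum_lfunE.
by apply: eq_bigr => i _; rewrite ract_homE.
Qed.

Let E := pid_rmod c.

Lemma pid_val (y : L) : c * y = y -> exists x : E, vsval x = y.
Proof.
move=> cy; exists (vsproj (limg (amull c)) y); rewrite vsprojK //.
by apply/memv_imgP; exists y; rewrite ?memvf // lfunE /= cy.
Qed.

Lemma pid_valc (x : E) : c * vsval x = vsval x.
Proof.
by have /memv_imgP[y _ ->] := subvsP x; rewrite lfunE /= mulrA cc.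
Qed.

Lemma pid_actE (x : E) a : vsval (ract x a) = vsval x * a.
Proof. exact: (sub_actE (@pid_is_submod _ _ c) x a). Qed.

Lemma pow_pid_hom (I : finType) N (y : I -> N) :
  exists2 f : 'Hom(pow_rmod I E, N), is_rhom f &
    f =1 fun x : {ffun I -> E} => \sum_i ract (y i) (vsval (x i)).
Proof.
apply: rhom_exists => [a u v|u a].
  rewrite scaler_sumr -big_split; apply: eq_bigr => i _.
  by rewrite !ffunE !linearP.
rewrite ract_suml; apply: eq_bigr => i _.
by rewrite !ffunE pid_actE ractA.
Qed.

Lemma pow_pid_in_add (I : finType) : in_add c (pow_rmod I E).
Proof.
have [u uE] := pid_val cc.
have hh i : exists2 h : 'Hom(pow_rmod I E, reg_rmod L), is_rhom h &
    h =1 fun x : {ffun I -> E} => vsval (x i).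
  by apply: rhom_exists => [a x y|x a]; rewrite !ffunE ?pid_actE.
have [h hhom hE] := fin_all_exists2 hh.
pose p i : {ffun I -> E} := [ffun j => if j == i then u else 0].
exists I, p, h; split=> //.
- move=> i; apply/ffunP => j; rewrite !ffunE; case: eqP => _.
    by apply: subvs_inj; rewrite pid_actE uE cc.
  exact: ract0l.
- by move=> i x; rewrite hE pid_valc.
move=> x; apply/ffunP => j; rewrite sum_ffunE (bigD1 j) //= big1 => [|i ij].
  rewrite addr0 !ffunE eqxx; apply: subvs_inj.
  by rewrite pid_actE uE hE pid_valc.
by rewrite !ffunE eq_sym (negPf ij) ract0l.
Qed.

Let gam (a : L) : G := vsproj (corner cc c0) (c * a * c).

Lemma corner_cut a : vsval (gam a) = c * a * c.
Proof. by apply: corner_projK; [rewrite !mulrA cc | rewrite -mulrA cc]. Qed.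

(** A basis of V defines a map from a power of cL onto VL, and (VL)c = V(cLc) = V because V = Vc. *)
Lemma submodule_image P (V : {vspace res P}) : is_submod V ->
  exists Q (f : 'Hom(Q, P)), [/\ in_add c Q, is_rhom f
    & forall y : res P, vsval y \in limg f <-> y \in V].
Proof.
move=> hV; pose v (l : 'I_(\dim V)) : res P := (vbasis V)`_l.
have [f hf fE] := pow_pid_hom (fun l => vsval (v l)).
exists (pow_rmod 'I_(\dim V) E), f; split=> [|//|y]; first exact: pow_pid_in_add.
split=> [/memv_imgP[x _ yE]|yV].
  have -> : y = \sum_(l < \dim V)
      ract (v l) (gam (vsval ((x : {ffun 'I_(\dim V) -> E}) l))).
    apply: subvs_inj; rewrite -res_valc yE fE ract_suml raddf_sum.
    apply: eq_bigr => l _; rewrite [RHS]res_actE corner_cut -ractA.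
    by congr ract; rewrite pid_valc.
  rewrite rpred_sum // => l _; apply/hV/vbasis_mem/mem_nth.
  by rewrite size_tuple.
have [u uE] := pid_val cc; apply/memv_imgP.
exists [ffun l : 'I_(\dim V) => coord (vbasis V) l y *: u]; rewrite ?memvf //.
rewrite fE {1}(coord_vbasis yV) raddf_sum; apply: eq_bigr => l _.
have vu b : vsval (b *: u) = b *: c by rewrite linearZ /= uE.
have vc b : ract (vsval (v l)) (b *: c) = b *: vsval (v l).
  by rewrite ractZr res_valc.
by rewrite ffunE vu vc.
Qed.

(* [N] is [M (x)_G cL], as the cokernel of a map between powers of [cL]. *)
Lemma induced_module (M : rmodule G) :
  exists2 N, presented_by c N & rmod_iso (res N) M.
Proof.
pose d := \dim {:M}; pose Q0 := pow_rmod 'I_d E.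
have [u uE] := pid_val cc.
have gamZ b : gam (vsval (b *: u)) = b *: 1.
  apply: subvs_inj; transitivity (b *: c).
    by rewrite corner_cut linearZ /= uE -scalerAr -scalerAl !cc.
  exact: (congr1 (fun t => b *: t) (esym (corner_val1 cc c0))).
(* The surjection from a power of cLc onto [M] given by a basis of [M]. *)
have [pi hpi piE] : exists2 pi : 'Hom(res Q0, M), is_rhom pi &
    forall x, pi x = \sum_(i < d)
      ract (vbasis {:M})`_i (gam (vsval ((vsval x : {ffun 'I_d -> E}) i))).
  apply: rhom_exists => [a x y|x a].
    rewrite scaler_sumr -big_split; apply: eq_bigr => i _.
    rewrite !linearP /= !ffunE -ract_linr; congr ract.
    by rewrite /gam -linearP; congr vsproj; rewrite linearP mulrDr mulrDl scalerAl -scalerAr.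
  rewrite ract_suml; apply: eq_bigr => i _; rewrite -ractA; congr ract.
  apply: subvs_inj; rewrite corner_cut res_actE ffunE pid_actE.
  rewrite [RHS](_ : _ = vsval (gam (vsval ((vsval x : {ffun 'I_d -> E}) i))) * vsval a) //.
  by rewrite corner_cut -!mulrA corner_mulr corner_mull.
(* The relations ker pi lie in Q0 c; [Q1] covers the submodule they generate in [Q0]. The cokernel
   restricts to (Q0 c) / ker pi, which is [M]. *)
have [Q1 [f [hQ1 hf fV]]] := submodule_image (lker_submod hpi).
have [N [p [hp sp kp]]] := quotient_rmod (limg_submod hf).
exists N.
  by exists Q1, Q0, f, p; split=> //; apply: pow_pid_in_add.
have [P hP PE] := res_hom cc c0 hp.
apply: (same_kernel_iso hP hpi).
- apply/surj_lfunP => y; have /surj_lfunP/(_ (vsval y))[x px] := sp.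
  have [z zE] := res_liftc cc c0 x; exists z; apply: subvs_inj.
  by rewrite -PE zE hp px res_valc.
- apply/surj_lfunP => m.
  have [z zE] : exists z : res Q0, vsval z =
      [ffun i : 'I_d => coord (vbasis {:M}) i m *: u] :> {ffun 'I_d -> E}.
    apply: res_lift => //; apply/ffunP => i; rewrite !ffunE; apply: subvs_inj.
    by rewrite pid_actE linearZ /= uE -scalerAl cc.
  exists z; rewrite piE [RHS](coord_vbasis (memvf m)); apply: eq_bigr => i _.
  by rewrite zE ffunE gamZ linearZ /= ract1.
apply/vspaceP => z; rewrite !memv_ker.
transitivity (p (vsval z) == 0).
  by rewrite PE -(inj_eq (@subvs_inj _ _ _)) linear0.
rewrite -!memv_ker kp; apply/idP/idP => /fV //.
Qed.
End Induction.

(** * Transfer of minimal presentations and tau-rigidity *)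

Section TauTransfer.
Variables (k : fieldType) (L : falgType k) (c : L).
Hypotheses (cc : idempotent_elt c) (c0 : c != 0).
Implicit Types (M N P Q : rmodule L).
Let G : falgType k := subvs_of (corner cc c0).
Local Notation res := (res_rmod cc c0).

Lemma superfluous_iso (A : falgType k) (M N K : rmodule A) (u : 'Hom(M, N))
    (v : 'Hom(N, M)) (p : 'Hom(N, K)) :
  is_rhom u -> is_rhom v -> cancel u v -> cancel v u ->
  superfluous (lker p) -> superfluous (lker (p \o u)%VF).
Proof.
move=> hu hv uK vK sp U hU UK; have uU : (u @: U)%VS = fullv.
  apply: sp; first exact: img_submod.
  apply/vspaceP => y; rewrite memvf.
  have : v y \in (U + lker (p \o u))%VS by rewrite UK memvf.
  move=> /memv_addP[a aU [b bK vy]]; apply/memv_addP.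
  exists (u a); first exact: memv_img.
  exists (u b); first by move: bK; rewrite !memv_ker comp_lfunE.
  by rewrite -linearD /= -vy vK.
apply/vspaceP => x; rewrite memvf.
have : u x \in (u @: U)%VS by rewrite uU memvf.
by move=> /memv_imgP[y yU /(can_inj uK) ->].
Qed.

(** Submodules are compared by V |-> VL and U |-> U meet Mc. The first satisfies (VL)c = V; and as
    [M] is generated by c, a submodule containing Mc is all of [M]. *)
Lemma superfluous_res M N (p : 'Hom(M, N)) (phi : 'Hom(res M, res N)) :
    generated_by c M -> is_rhom p -> is_rhom phi -> extends p phi ->
  superfluous (lker p) <-> superfluous (lker phi).
Proof.
move=> gM hp hphi pphi.
have kE x : (vsval x \in lker p) = (x \in lker phi).
  by rewrite !memv_ker pphi -(inj_eq (@subvs_inj _ _ _)) linear0.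
split=> [sp V hV VK|sphi U hU UK].
  have [Q [f [_ hf fV]]] := submodule_image hV.
  have fK : (limg f + lker p)%VS = fullv.
    apply: (generated_by_res gM (addv_submod (limg_submod hf) (lker_submod hp))).
    move=> x; have : x \in (V + lker phi)%VS by rewrite VK memvf.
    move=> /memv_addP[a /fV aV [b bK ->]].
    by rewrite linearD memv_add //= kE.
  have fF : limg f = fullv by apply: sp => //; apply: limg_submod.
  by apply/vspaceP => x; rewrite memvf; apply/fV; rewrite fF memvf.
have vlin : linear (fun x : res M => vsval x) by [].
pose W : {vspace res M} := (linfun (fun x : res M => vsval x) @^-1: U)%VS.
have WE x : (x \in W) = (vsval x \in U).
  by rewrite -memv_preim (linear_linfunE vlin).
have WF : W = fullv.
  apply: sphi => [x a|]; first by rewrite !WE res_actE => /hU.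
  apply/vspaceP => x; rewrite memvf.
  have : vsval x \in (U + lker p)%VS by rewrite UK memvf.
  move=> /memv_addP[a aU [b bK xab]].
  have [a' aE] := res_liftc cc c0 a; have [b' bE] := res_liftc cc c0 b.
  have -> : x = a' + b'.
    by apply: subvs_inj; rewrite linearD /= aE bE -ractDl -xab res_valc.
  rewrite memv_add ?WE ?aE ?hU // -kE bE.
  exact: lker_submod.
by apply: (generated_by_res gM hU) => x; rewrite -WE WF memvf.
Qed.

(** The functor N |-> Nc is exact, since multiplying a preimage by c yields a preimage of the same
    element of Nc. *)
Lemma presentation_res P1 P0 N (f : 'Hom(P1, P0)) (p : 'Hom(P0, N))
    (F : 'Hom(res P1, res P0)) (P : 'Hom(res P0, res N)) :
    presentation f p -> is_rhom F -> is_rhom P -> extends f F -> extends p P ->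
  presentation F P.
Proof.
move=> pres hF hP fF pP; have [hf hp sp fp] := pres.
split=> //.
  apply/surj_lfunP => y; have /surj_lfunP/(_ (vsval y))[x px] := sp.
  have [z zE] := res_liftc cc c0 x; exists z; apply: subvs_inj.
  by rewrite -pP zE hp px res_valc.
apply/vspaceP => x; rewrite memv_ker; apply/memv_imgP/eqP => [[y _ ->]|Px].
  by apply: subvs_inj; rewrite -pP -fF (presentation0 _ pres) linear0.
have : vsval x \in lker p by rewrite memv_ker pP Px linear0.
rewrite -fp => /memv_imgP[y _ xE].
have [z zE] := res_liftc cc c0 y; exists z; rewrite ?memvf //.
by apply: subvs_inj; rewrite -fF zE hf -xE res_valc.
Qed.

(** Only exactness at [P0] is delicate. The cokernel C of [f] is presented by cL too, and its
    restriction has the same relations as Nc. The induced map Nc -> Cc extends to a left inverse of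
    C -> N, so ker p lies in the image of [f]. *)
Lemma presentation_ext P1 P0 N (f : 'Hom(P1, P0)) (p : 'Hom(P0, N))
    (F : 'Hom(res P1, res P0)) (P : 'Hom(res P0, res N)) :
    in_add c P1 -> in_add c P0 -> presented_by c N ->
    is_rhom f -> is_rhom p -> extends f F -> extends p P ->
  presentation F P -> presentation f p.
Proof.
move=> h1 h0 pN hf hp fF pP presG; have [hF hP sP FP] := presG.
have sp : limg p = fullv.
  apply: (generated_by_res (presented_generated pN) (limg_submod hp)) => y.
  by have /surj_lfunP/(_ y)[x <-] := sP; rewrite -pP memv_img ?memvf.
have pf x : p (f x) = 0.
  have pf0 : (p \o f)%VF =1 (0 : 'Hom(P1, N)).
    apply: (generated_by_res_eq (in_add_generated h1)) => [||y].
    - exact: comp_rhom.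
    - exact: zero_rhom.
    by rewrite comp_lfunE fF pP (presentation0 _ presG) linear0 zero_lfunE.
  by have := pf0 x; rewrite comp_lfunE zero_lfunE.
split=> //; apply/eqP; rewrite eqEsubv; apply/andP; split.
  by apply/subvP => _ /memv_imgP[x _ ->]; rewrite memv_ker pf.
have [C [q [hq sq kq]]] := quotient_rmod (limg_submod hf).
have pC : presented_by c C by exists P1, P0, f, q.
have [|v hv vE] := rhom_factor hq hp sq.
  by rewrite kq; apply/subvP => _ /memv_imgP[x _ ->]; rewrite memv_ker pf.
have [V hV VE] := res_hom cc c0 hv; have [Q hQ QE] := res_hom cc c0 hq.
have [hF' _ sQ FQ] : @presentation k G _ _ _ F Q.
  by apply: presentation_res fF QE => //.
have [w hw wE] : exists2 w : 'Hom(res N, res C), is_rhom w &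
    forall x, w (P x) = Q x.
  by apply: rhom_factor => //; rewrite -FP FQ subvv.
have [W hW WE] := presented_extend pN hw.
have Wv : (W \o v)%VF =1 \1%VF.
  apply: (generated_by_res_eq (presented_generated pC)) => [||y].
  - exact: comp_rhom.
  - exact: id_rhom.
  have /surj_lfunP/(_ y)[x <-] := sQ.
  by rewrite comp_lfunE id_lfunE -QE vE pP WE wE QE.
apply/subvP => x; rewrite -kq !memv_ker => /eqP px.
by have := Wv (q x); rewrite comp_lfunE id_lfunE vE px linear0 => <-.
Qed.

Lemma hom_zero_res M N : presented_by c M ->
  hom_zero M N <-> hom_zero (res M) (res N).
Proof.
move=> pM; split=> h0 f hf.
  have [g hg gE] := presented_extend pM hf; apply/lfunP => x.
  by apply: subvs_inj; rewrite -gE (h0 g) // !zero_lfunE linear0.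
have [F hF FE] := res_hom cc c0 hf.
apply/lfunP; apply: (generated_by_res_eq (presented_generated pM)) => //.
  exact: zero_rhom.
by move=> x; rewrite FE (h0 F) // !zero_lfunE linear0.
Qed.

(** Minimality puts the presentation of [N] into the domain of the equivalence, so it restricts to a
    minimal one. A map P1 c -> Nc is extended, factored over [L] and restricted again. *)
Lemma tau_rigid_res N : presented_by c N -> tau_rigid N -> tau_rigid (res N).
Proof.
move=> pN /tau_rigidP[P1 [P0 [f [p [mfp fN]]]]]; apply/tau_rigidP.
have [h1 h0] := min_presentation_in_add cc pN mfp.
have [[prP0 hp sp] limp [prP1 hf sf] fp] := mfp.
have [F hF FE] := res_hom cc c0 hf; have [P hP PE] := res_hom cc c0 hp.
have [_ _ sP FP] : presentation F P by apply: (presentation_res _ hF hP FE PE).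
exists (res P1), (res P0), F, P; split.
  split=> //; split=> //; try exact/in_add_projective/res_in_add.
    exact/(superfluous_res (in_add_generated h0) hp hP PE).
  exact/(superfluous_res (in_add_generated h1) hf hF FE).
move=> g hg; have [g' hg' gE] := in_add_extend h1 hg.
have [h hh hE] := fN g' hg'; have [H hH HE] := res_hom cc c0 hh.
exists H => // x; apply: subvs_inj.
by rewrite -gE hE FE HE.
Qed.

Lemma res_tau_rigid N : presented_by c N -> tau_rigid (res N) -> tau_rigid N.
Proof.
move=> pN /tau_rigidP[R1 [R0 [f [p [mfp fN]]]]]; apply/tau_rigidP.
have [[prR0 hp sp] limp [prR1 hf sf] fp] := mfp.
have [P1 pP1 i1] := induced_module R1; have [P0 pP0 i0] := induced_module R0.
have /rmod_isoP[u1 [v1 [hu1 hv1 uK1 vK1]]] := i1.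
have /rmod_isoP[u0 [v0 [hu0 hv0 uK0 vK0]]] := i0.
have h1 : in_add c P1.
  apply/(in_add_res pP1)/(in_add_projective (c := 1)).
  exact/(iso_in_add i1)/projective_in_add1.
have h0 : in_add c P0.
  apply/(in_add_res pP0)/(in_add_projective (c := 1)).
  exact/(iso_in_add i0)/projective_in_add1.
(* The presentation over [G] is conjugated so that its terms are literally restrictions of [P1] and
   [P0]; only then can its maps be extended. *)
have hP := comp_rhom hp hu0; have hF := comp_rhom hv0 (comp_rhom hf hu1).
have [p' hp' pE] := in_add_extend h0 hP.
have [f' hf' fE] := in_add_extend h1 hF.
have presG : presentation (v0 \o (f \o u1))%VF (p \o u0)%VF.
  split=> //.
    apply/surj_lfunP => y; have /surj_lfunP/(_ y)[x <-] := limp.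
    by exists (v0 x); rewrite comp_lfunE vK0.
  apply/vspaceP => x; rewrite memv_ker !comp_lfunE -memv_ker -fp.
  apply/memv_imgP/memv_imgP => [[y _ ->]|[y _ xy]].
    by exists (u1 y); rewrite ?memvf // !comp_lfunE vK0.
  by exists (v1 y); rewrite ?memvf // !comp_lfunE vK1 -xy uK0.
have [_ _ limp' fp'] := presentation_ext h1 h0 pN hf' hp' fE pE presG.
exists P1, P0, f', p'; split.
  split=> //; split=> //; try exact: in_add_projective.
  - by apply: in_add_projective h0.
  - apply/(superfluous_res (in_add_generated h0) hp' hP pE).
    exact: superfluous_iso hu0 hv0 uK0 vK0 sp.
  - by apply: in_add_projective h1.
  apply/(superfluous_res (in_add_generated h1) hf' hF fE).
  have -> : lker (v0 \o (f \o u1))%VF = lker (f \o u1)%VF.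
    apply/vspaceP => x; rewrite !memv_ker comp_lfunE.
    apply/eqP/eqP => [|->]; last by rewrite linear0.
    by move/(congr1 u0); rewrite vK0 linear0.
  exact: superfluous_iso hu1 hv1 uK1 vK1 sf.
move=> g hg; have [g' hg' gE] := res_hom cc c0 hg.
(* Restrict g, move it to [R1], factor it there through [f], and extend the factor back to [P0]. *)
have [h hh hE] := fN _ (comp_rhom hg' hv1).
have [H hH HE] := in_add_extend h0 (comp_rhom hh hu0).
exists H => //.
have gH : g =1 (H \o f')%VF.
  apply: (generated_by_res_eq (presented_generated pP1)) => [||x] //.
    exact: comp_rhom.
  by rewrite gE comp_lfunE fE HE !comp_lfunE vK0 -hE comp_lfunE uK1.
by move=> x; rewrite gH comp_lfunE.
Qed.
End TauTransfer.

(** * Primitive idempotents and decompositions *)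

Section Local.
Variables (k : fieldType) (L : falgType k).

(** Row vectors of length dim A + 1 encode the polynomials of degree at most dim A; evaluation at
    [u] has a kernel for reasons of dimension. *)
Lemma annihilating_poly (A : falgType k) (u : A) :
  exists2 q : {poly k}, q != 0 & horner_alg u q = 0.
Proof.
pose d := \dim {:A}.
have [F FE] : exists F : 'Hom('rV[k]_d.+1, A),
    F =1 fun r => horner_alg u (rVpoly r).
  apply: linear_lfun => a x y; by rewrite linearP /= linearP /= mulr_algl.
have : (0 < \dim (lker F))%N.
  have := limg_ker_dim F fullv; rewrite capfv => dE.
  have : (\dim (limg F) <= d)%N by rewrite dimvS ?subvf.
  rewrite -(leq_add2l (\dim (lker F))) dE dimvf.
  rewrite [dim _]mul1n; by case: (\dim (lker F)) => //; rewrite add0n ltnn.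
rewrite lt0n dimv_eq0 -vpick0; set r := vpick _ => r0.
exists (rVpoly r).
  by apply: contraNneq r0 => r0; rewrite -[r]rVpolyK r0 linear0.
have : r \in lker F by apply: memv_pick.
by rewrite memv_ker FE => /eqP.
Qed.

(* Splitting an annihilating polynomial of [u] as [q * 'X^m] with [q.[0] != 0]
   gives a decomposition of 1 into orthogonal idempotents. *)
Lemma unit_or_nilpotent (A : falgType k) (u : A) :
    (forall f g : A, f * f = f -> g * g = g -> f * g = 0 -> g * f = 0 ->
       1 = f + g -> f = 0 \/ g = 0) ->
  u \is a GRing.unit \/ exists m, u ^+ m = 0.
Proof.
move=> prim; have [q0 q00 q0u] := annihilating_poly u.
have [m [q q0n]] := multiplicity_XsubC q0 0; rewrite q00 /= in q0n *.
rewrite subr0 => q0E.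
(* One factor 'X more than the multiplicity, so that a 'X^(m+1) = (a 'X^m) 'X exhibits an inverse of
   [u] even when m = 0. *)
have cop : coprimep ('X^(m.+1)) q.
  by rewrite coprimep_sym coprimep_expr // -['X]subr0 coprimep_XsubC.
have /Bezout_eq1_coprimepP[[a b] /= abE] := cop.
pose ev p : A := horner_alg u p.
have evM p p' : ev (p * p') = ev p * ev p' by exact: rmorphM.
have evC p p' : ev p * ev p' = ev p' * ev p by rewrite -!evM mulrC.
have evX : ev 'X = u by exact: horner_algX.
have ev0 : ev (q * 'X^(m.+1)) = 0.
  by rewrite exprSr mulrA -q0E evM [ev q0]q0u mul0r.
pose f := ev (a * 'X^(m.+1)); pose g := ev (b * q).
have fg1 : 1 = f + g.
  by rewrite -[RHS](rmorphD (horner_alg u)) /= abE rmorph1.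
have fg : f * g = 0.
  rewrite /f /g evC -evM mulrACA evM.
  by rewrite ev0 mulr0.
have gf : g * f = 0 by rewrite /f /g evC.
have ff : f * f = f by rewrite -[RHS]mulr1 fg1 mulrDr fg addr0.
have gg : g * g = g by rewrite -[RHS]mulr1 fg1 mulrDr gf add0r.
have [z0|z0] := prim f g ff gg fg gf fg1.
  right; exists m.+1.
  have -> : u ^+ m.+1 = ev 'X^(m.+1) by rewrite -evX; exact/esym/rmorphXn.
  rewrite -[LHS]mul1r fg1 z0 add0r /g -evM -mulrA evM.
  by rewrite ev0 mulr0.
left; apply/unitrP; exists (ev (a * 'X^m)).
have E : ev (a * 'X^m) * u = 1.
  by rewrite -[X in _ * X = _]evX -evM -mulrA -exprSr fg1 z0 addr0.
by split=> //; rewrite -[RHS]E -evX evC.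
Qed.

(** Primitivity says that the unit of cLc has no nontrivial decomposition, so [u] is invertible or
    nilpotent there. In the nilpotent case the geometric series inverts c - u. *)
Lemma primitive_local (c u : L) : primitive_idempotent c ->
    c * u = u -> u * c = u ->
  (exists v, [/\ c * v = v, v * c = v, u * v = c & v * u = c]) \/
  (exists v, [/\ c * v = v, v * c = v, (c - u) * v = c & v * (c - u) = c]).
Proof.
move=> [cc c0 prim] cu uc; pose G : falgType k := subvs_of (corner cc c0).
have val1 : vsval (1 : G) = c by apply: corner_val1.
pose U : G := vsproj (corner cc c0) u.
have UE : vsval U = u by apply: corner_projK.
have unit_val (V : G) : V \is a GRing.unit -> exists v, [/\ c * v = v, v * c = v,
    vsval V * v = c & v * vsval V = c].
  move=> hV; exists (vsval V^-1); split; rewrite ?corner_mull ?corner_mulr //.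
    exact: etrans (congr1 vsval (mulrV hV)) val1.
  exact: etrans (congr1 vsval (mulVr hV)) val1.
have [|hU|[m Um]] := @unit_or_nilpotent G U.
- move=> f g /(congr1 vsval) ff /(congr1 vsval) gg /(congr1 vsval) fg.
  move=> /(congr1 vsval) gf /(congr1 vsval) fg1.
  have [|z0|z0] := prim (vsval f) (vsval g) ff gg fg gf.
  - exact: etrans (esym val1) fg1.
  - by left; apply: subvs_inj.
  by right; apply: subvs_inj.
- by left; rewrite -UE; apply: unit_val.
right; have -> : c - u = vsval (1 - U).
  by rewrite linearB /= UE; congr (_ - _); exact/esym.
apply: unit_val; apply/unitrP.
exists (\sum_(i < m) U ^+ i).
have E : (1 - U) * (\sum_(i < m) U ^+ i) = 1.
  by rewrite -opprB mulNr -subrX1 Um sub0r opprK.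
split=> //; rewrite -[RHS]E; symmetry; apply: commr_sum => i _.
apply/commrX/commr_sym/commrB; [exact: commr1 | exact: commr_refl].
Qed.
End Local.

(** * Decomposing projectives into the modules e_i L *)

Section Decomposition.
Variables (k : fieldType) (L : falgType k).
Implicit Types (M N P Q : rmodule L).

Lemma split_iso (E P : rmodule L) (i : 'Hom(E, P)) (r : 'Hom(P, E)) :
    is_rhom i -> is_rhom r -> cancel i r ->
  exists (K : rmodule L) (j : 'Hom(K, P)) (q : 'Hom(P, K)),
    [/\ is_rhom j, is_rhom q, forall x, r (j x) = 0,
        cancel j q & rmod_iso P (dsum_rmod E K)].
Proof.
move=> hi hr ir; pose K := sub_rmod (lker_submod hr).
have rK (x : K) : r (vsval x) = 0.
  by apply/eqP; rewrite -memv_ker; apply: subvsP.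
pose q0 (x : P) : K := vsproj (lker r) (x - i (r x)).
have qK x : vsval (q0 x) = x - i (r x).
  by rewrite vsprojK // memv_ker linearB /= ir subrr.
have [j hj jE] : exists2 j : 'Hom(K, P), is_rhom j & j =1 fun x : K => vsval x.
  by apply: rhom_exists => // x a; apply: (sub_actE (lker_submod hr)).
have [q hq qE] : exists2 q : 'Hom(P, K), is_rhom q & q =1 q0.
  apply: rhom_exists => [a x y|x a]; apply: subvs_inj.
    by rewrite [RHS]linearP !qK !linearP /= addrACA -scalerDr !qK.
  by rewrite [RHS](sub_actE (lker_submod hr)) !qK hr hi ractBl.
have jq x : j (q x) = x - i (r x) by rewrite jE qE qK.
have qj x : q (j x) = x.
  by apply: subvs_inj; rewrite qE qK jE rK linear0 subr0.
exists K, j, q; split=> //; first by move=> x; rewrite jE rK.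
have [F hF FE] : exists2 F : 'Hom(P, dsum_rmod E K), is_rhom F &
    F =1 fun x => (r x, q x).
  by apply: rhom_exists => [a x y|x a]; congr pair; rewrite /= ?linearP ?hr ?hq.
exists F => //; exists (fun z => i z.1 + j z.2) => [x|[x y]]; rewrite FE /=.
  by rewrite jq subrKC.
congr pair; rewrite linearD /= ?ir ?qj.
  by rewrite jE rK addr0.
suff -> : q (i x) = 0 by rewrite add0r.
by apply: subvs_inj; rewrite qE qK ir subrr linear0.
Qed.

Lemma pid_hom (c : L) N (y : N) :
  exists2 f : 'Hom(pid_rmod c, N), is_rhom f & forall x, f x = ract y (vsval x).
Proof.
apply: rhom_exists => [a u v|u a]; first by rewrite !linearP.
by rewrite pid_actE ractA.
Qed.

Variables (n : nat) (e : 'I_n -> L).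
Hypothesis prim : forall i, primitive_idempotent (e i).
Let E i := pid_rmod (e i).

(** Induction on the size of a dual basis: by locality of e_i L e_i, each member either splits off a
    summand e_i L or can be eliminated. Following the indices [t] shows which e_i L occur. *)
Lemma decompose_dual_basis (I : finType) (A : {set I}) P (t : I -> 'I_n)
    (p : I -> P) (h : I -> 'Hom(P, reg_rmod L)) :
    (forall i, is_rhom (h i)) -> (forall i, ract (p i) (e (t i)) = p i) ->
    (forall i x, e (t i) * h i x = h i x) ->
    (forall x, x = \sum_(i in A) ract (p i) (h i x)) ->
  exists s : seq 'I_n, {subset s <= [set t i | i in A]} /\
    rmod_iso P (bigdsum_rmod (map E s)).
Proof.
have [m] := ubnP #|A|; elim: m => // m IHm in A P p h *; rewrite ltnS => Am.
move=> hh pe eh ph; have [A0|/set0Pn[a aA]] := eqVneq A set0.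
  exists [::]; split=> //; apply: zero_iso; last exact: zero_rmod_zero.
  by move=> x; rewrite (ph x) A0 big_set0.
have cardA : (#|A :\ a| < m)%N by rewrite (cardsD1 a) aA add1n in Am.
have subA : [set t i | i in A :\ a] \subset [set t i | i in A].
  by apply/imsetS/subD1set.
have [ee _ _] := prim (t a).
pose u : L := h a (p a).
have he i j : h i (p j) * e (t j) = h i (p j) :> L.
  by rewrite -[in RHS]pe hh.
have [||[v [ev ve uv vu]]|[v [ev ve uv vu]]] := primitive_local (prim (t a)) (u := u).
- exact: eh.
- exact: he.
(* If u = h_a(p_a) has inverse v, then y |-> p_a v y is a section of h_a and e_i L splits off. On
   the complement h_a vanishes, so the remaining members form a dual basis of it. *)
- have [i hi iE] := pid_hom (e (t a)) (ract (p a) v).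
  have [r hr rE] : exists2 r : 'Hom(P, E (t a)), is_rhom r &
      forall x, vsval (r x) = h a x :> L.
    pose r0 x : E (t a) := vsproj (limg (amull (e (t a)))) (h a x).
    have rK x : vsval (r0 x) = h a x.
      rewrite vsprojK // -[h a x]eh; apply/memv_imgP.
      by exists (h a x); rewrite ?memvf // lfunE.
    have [r hr rE] : exists2 r : 'Hom(P, E (t a)), is_rhom r & r =1 r0.
      apply: rhom_exists => [b x y|x b]; first by rewrite /r0 !linearP.
      by apply: subvs_inj; rewrite pid_actE !rK hh.
    by exists r => // x; rewrite rE rK.
  have ir : cancel i r.
    move=> x; apply: subvs_inj; rewrite rE iE !hh /= -/u uv.
    exact: (pid_valc ee).
  have [K [j [q [hj hq rj jq iP]]]] := split_iso hi hr ir.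
  have [|||x|s [sA iK]] := IHm _ K (fun l => q (p l)) (fun l => h l \o j)%VF cardA.
  - by move=> l; apply: comp_rhom.
  - by move=> l; rewrite -hq pe.
  - by move=> l x; rewrite comp_lfunE eh.
  - rewrite -{1}(jq x) {1}(ph (j x)) raddf_sum (big_setD1 a) //=.
    rewrite -rE rj !linear0 add0r.
    by apply: eq_bigr => l _; rewrite hq comp_lfunE.
  exists (t a :: s); split.
    move=> l; rewrite inE => /orP[/eqP ->|/sA]; first exact: imset_f.
    exact: (subsetP subA).
  apply: rmod_iso_trans iP _; apply: dsum_iso => //; exact: rmod_iso_refl.
(* If e_i - u has inverse v, expanding h_a(x) along the dual basis and solving for h_a(x) expresses
   h_a through the others. Then p_a is absorbed by replacing p_l with p_l + p_a v h_a(p_l). *)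
have haE x : h a x = v * (\sum_(i in A :\ a) h a (p i) * h i x) :> L.
  have E1 : h a x = u * h a x + \sum_(i in A :\ a) h a (p i) * h i x :> L.
    rewrite {1}(ph x) raddf_sum (big_setD1 a) //=; congr (_ + _).
      by rewrite hh.
    by apply: eq_bigr => l _; rewrite hh.
  have -> : \sum_(i in A :\ a) h a (p i) * h i x = (e (t a) - u) * h a x :> L.
    by rewrite mulrBl eh {1}E1 addrC addKr.
  by rewrite mulrA vu eh.
have [||||s [sA iP]] := IHm _ P
  (fun l => p l + ract (p a) (v * h a (p l))) h cardA.
- exact: hh.
- by move=> l; rewrite ractDl pe -ractA -mulrA he.
- exact: eh.
- move=> x; rewrite {1}(ph x) (big_setD1 a) //= haE.
  under [RHS]eq_bigr do rewrite ractDl -ractA.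
  rewrite big_split /= addrC; congr (_ + _).
  rewrite mulr_sumr ract_sumr; apply: eq_bigr => l _.
  by rewrite mulrA.
by exists s; split=> // l /sA; apply: (subsetP subA).
Qed.

Lemma perm_bigdsum (s s' : seq 'I_n) : perm_eq s s' ->
  rmod_iso (bigdsum_rmod (map E s)) (bigdsum_rmod (map E s')).
Proof.
have extract x (s0 : seq 'I_n) : x \in s0 ->
    rmod_iso (bigdsum_rmod (map E s0))
             (dsum_rmod (E x) (bigdsum_rmod (map E (rem x s0)))).
  elim: s0 => //= y s0 IH; rewrite inE eq_sym.
  have [->|yx] := eqVneq y x => /= [_|xs]; first exact: rmod_iso_refl.
  apply: rmod_iso_trans (dsum_swap _ _ _).
  by apply: dsum_iso; [apply: rmod_iso_refl | apply: IH].
elim: s s' => [|x s IH] s' ss'.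
  by move/perm_size: ss' => /esym/size0nil ->; apply: rmod_iso_refl.
have xs' : x \in s' by rewrite -(perm_mem ss') mem_head.
apply/rmod_iso_sym; apply: rmod_iso_trans (extract _ _ xs') _.
apply: dsum_iso; first exact: rmod_iso_refl.
apply/rmod_iso_sym/IH; rewrite -(perm_cons x).
by apply: perm_trans ss' (perm_to_rem xs').
Qed.

Let expand (a : 'I_n -> nat) := flatten [seq nseq (a i) i | i <- enum 'I_n].

Lemma proj_sumE a : proj_sum e a = bigdsum_rmod (map E (expand a)).
Proof.
rewrite /proj_sum /expand map_flatten -map_comp; congr (bigdsum_rmod (flatten _)).
by apply: eq_map => i /=; rewrite map_nseq.
Qed.

Lemma count_expand a j : count_mem j (expand a) = a j.
Proof.
rewrite /expand count_flatten -map_comp sumnE big_map big_enum /=.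
rewrite (bigD1 j) //= big1 => [|i ij]; rewrite count_nseq /=.
  by rewrite eqxx mul1n addn0.
by rewrite (negPf ij).
Qed.

Lemma bigdsum_proj_sum (s : seq 'I_n) :
  rmod_iso (bigdsum_rmod (map E s)) (proj_sum e (fun i => count_mem i s)).
Proof.
rewrite proj_sumE; apply: perm_bigdsum; apply/allP => i _ /=.
by rewrite count_expand.
Qed.

Lemma bigdsum_in_add c (s : seq 'I_n) :
    (forall i, i \in s -> c * e i = e i /\ e i * c = e i) ->
  in_add c (bigdsum_rmod (map E s)).
Proof.
elim: s => [_|i s IH cs] /=; first exact: zero_in_add.
have [ce ec] := cs i (mem_head _ _); have [ee _ _] := prim i.
apply: dsum_in_add; last by apply: IH => j js; apply/cs/mem_behead.
have [u uE] := pid_val ee.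
have [h hh hE] : exists2 h : 'Hom(E i, reg_rmod L), is_rhom h &
    h =1 fun x : E i => vsval x.
  by apply: rhom_exists => // x a; apply: pid_actE.
exists unit, (fun=> u), (fun=> h); split=> //.
- by move=> _; apply: subvs_inj; rewrite pid_actE uE ec.
- by move=> _ x; rewrite hE -(pid_valc ee x) mulrA ce.
move=> x; rewrite (big_pred1 tt) //.
by apply: subvs_inj; rewrite pid_actE uE hE pid_valc.
Qed.

Lemma retract_bigdsum (s : seq 'I_n) i : i \in s ->
  retract (E i) (bigdsum_rmod (map E s)).
Proof.
elim: s => //= j s IH; rewrite inE => /orP[/eqP ->|/IH iS].
  exact: retract_dsuml.
exact: retract_trans iS (retract_dsumr _ _).
Qed.

End Decomposition.

(** * Minimal presentations and g-vectors *)

Section MinimalPresentations.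
Variables (k : fieldType) (L : falgType k).
Implicit Types (M N P Q : rmodule L).

Lemma min_presentation_surj P1 P0 (P1' P0' : rmodule L) M (f : 'Hom(P1, P0)) (p : 'Hom(P0, M))
    (f' : 'Hom(P1', P0')) (p' : 'Hom(P0', M)) :
    min_proj_presentation f p -> min_proj_presentation f' p' ->
  exists (u1 : 'Hom(P1, P1')) (u0 : 'Hom(P0, P0')),
    [/\ is_rhom u1, is_rhom u0, limg u1 = fullv, limg u0 = fullv
      & forall x, f' (u1 x) = u0 (f x)].
Proof.
move=> [[/projective_in_add1 prP0 hp sp] limp [/projective_in_add1 prP1 hf sf] fp].
move=> [[prP0' hp' sp'] limp' [prP1' hf' sf'] fp'].
have [|u0 hu0 u0E] := in_add_lift prP0 hp' hp; first by rewrite limp' subvf.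
have pf x : p (f x) = 0.
  by apply/eqP; rewrite -memv_ker -fp memv_img ?memvf.
have [|u1 hu1 u1E] := in_add_lift prP1 hf' (comp_rhom hu0 hf).
  rewrite fp'; apply/subvP => _ /memv_imgP[x _ ->].
  by rewrite memv_ker comp_lfunE u0E pf.
have su0 : limg u0 = fullv.
  apply: superfluous_surj hu0 sp' _ => x.
  by have /surj_lfunP/(_ (p' x))[y <-] := limp; exists y.
exists u1, u0; split=> // [|x]; last by rewrite u1E comp_lfunE.
apply: superfluous_surj hu1 sf' _ => x.
have /surj_lfunP/(_ (f' x))[y yx] := su0.
have : y \in lker p.
  by rewrite memv_ker -u0E yx -memv_ker -fp' memv_img ?memvf.
by rewrite -fp => /memv_imgP[z _ zy]; exists z; rewrite u1E comp_lfunE -zy.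
Qed.

(* Surjections in both directions force equal dimensions, hence [u1] below is an
   isomorphism. *)
Lemma min_presentation_factors P1 P0 (P1' P0' : rmodule L) M (f : 'Hom(P1, P0))
    (p : 'Hom(P0, M)) (f' : 'Hom(P1', P0')) (p' : 'Hom(P0', M)) :
    min_proj_presentation f p -> min_proj_presentation f' p' ->
  factors_through f' M -> factors_through f M.
Proof.
move=> mf mf' fac g hg.
have [u1 [u0 [hu1 hu0 su1 _ u1E]]] := min_presentation_surj mf mf'.
have [w1 [_ [_ _ sw1 _ _]]] := min_presentation_surj mf' mf.
have ku1 : lker u1 = 0%VS.
  have := limg_ker_dim w1 fullv; have := limg_ker_dim u1 fullv.
  rewrite !capfv su1 sw1 => dimu dimw; apply/eqP.
  by rewrite -dimv_eq0 -leqn0 -(leq_add2r (\dim {:P1'})) dimu add0n -dimw leq_addl.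
have [|g' hg' g'E] := rhom_factor hu1 hg su1; first by rewrite ku1 sub0v.
have [h hh hE] := fac g' hg'; exists (h \o u0)%VF; first exact: comp_rhom.
by move=> x; rewrite -g'E hE u1E comp_lfunE.
Qed.

(** Pulling [U] back along [u] gives a submodule that together with [K] spans [P], hence equals [P];
    then [U] contains the image of [u]. *)
Lemma superfluous_img P Q (K : {vspace P}) (u : 'Hom(P, Q)) :
  is_rhom u -> superfluous K -> superfluous (u @: K)%VS.
Proof.
move=> hu sK U hU UK.
have uU : (u @^-1: U)%VS = fullv.
  apply: sK; first exact: preim_submod.
  apply/vspaceP => x; rewrite memvf.
  have : u x \in (U + u @: K)%VS by rewrite UK memvf.
  move=> /memv_addP[a aU [_ /memv_imgP[b bK ->] xab]].
  apply/memv_addP; exists (x - b); last by exists b; rewrite ?subrK.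
  by rewrite -memv_preim linearB /= xab addrK.
apply/eqP; rewrite eqEsubv subvf -UK subv_add subvv /=.
apply/subvP => _ /memv_imgP[x _ ->].
by rewrite memv_preim uU memvf.
Qed.

Lemma superfluous_full P (K K' : {vspace P}) :
    is_submod K -> superfluous K -> superfluous K' -> (K + K')%VS = fullv ->
  rmod_zero P.
Proof.
move=> hK sK sK' KK'; have KF := sK' _ hK KK'.
have h0 : is_submod (0%VS : {vspace P}).
  by move=> x a; rewrite !memv0 => /eqP ->; rewrite ract0l.
have F0 : (0%VS : {vspace P}) = fullv by apply: sK => //; rewrite add0v.
by move=> x; apply/eqP; rewrite -memv0 F0 memvf.
Qed.

(* A common summand [E] gives a map P1 + P -> E -> P0 -> M; rigidity makes it
   factor through [f], so the identity of [E] is the sum of two maps with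
   superfluous image. *)
Lemma rigid_no_common_summand M P P1 P0 (f : 'Hom(P1, P0)) (p : 'Hom(P0, M))
    (E : rmodule L) :
    min_proj_presentation f p -> factors_through f M -> hom_zero P M ->
    retract E P0 -> retract E (dsum_rmod P1 P) ->
  rmod_zero E.
Proof.
move=> [[/projective_in_add1 prP0 hp sp] limp _ fp] fac PM.
move=> [t [t' [ht ht' tK]]] [s' [s [hs' hs sK]]].
have [i1 hi1 i1E] := dinl_exists P1 P; have [i2 hi2 i2E] := dinr_exists P1 P.
have hpt := comp_rhom hp ht; have hg := comp_rhom hpt hs.
have [h hh hE] := fac _ (comp_rhom hg hi1).
have [|h' hh' h'E] := in_add_lift prP0 hp hh; first by rewrite limp subvf.
(* On the summand [P] the map to [M] is zero because Hom(P, M) = 0; on [P1] it factors through [f],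
   and the factor lifts to h' : P0 -> P0. *)
have key y : p (t (s y)) = p (h' (f y.1)).
  have -> : p (t (s y)) = (((p \o t) \o s) \o i1)%VF y.1
      + (((p \o t) \o s) \o i2)%VF y.2.
    rewrite !comp_lfunE i1E i2E -!linearD /=; congr (p (t (s _))).
    by case: (y) => a b; congr pair; rewrite /= ?addr0 ?add0r.
  by rewrite (PM _ (comp_rhom hg hi2)) zero_lfunE addr0 hE h'E.
have hK := lker_submod hp.
apply: (superfluous_full (img_submod ht' hK) (superfluous_img ht' sp)
  (superfluous_img (comp_rhom ht' hh') sp)).
apply/vspaceP => x; rewrite memvf; apply/memv_addP.
(* With s z = x, split x = t'(t(s z)) as t'(t(s z) - h'(f z_1)) + t'(h'(f z_1)). The difference lies
   in ker p by [key], and f z_1 lies in im f = ker p. *)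
pose z := s' x; exists (t' (t (s z) - h' (f z.1))).
  by apply: memv_img; rewrite memv_ker linearB /= key subrr.
exists ((t' \o h')%VF (f z.1)); first by rewrite memv_img // -fp memv_img ?memvf.
by rewrite comp_lfunE linearB /= subrK /z sK tK.
Qed.
End MinimalPresentations.

(** * Pairs presented by cL and the support of g-vectors *)

Section Pairs.
Variables (k : fieldType) (L : falgType k).
Implicit Types (X Y Z : rpair L) (c : L).

Definition presented_pair c X := presented_by c X.1 /\ in_add c X.2.

Lemma pair_iso_refl X : pair_iso X X.
Proof. by split; apply: rmod_iso_refl. Qed.

Lemma pair_iso_sym X Y : pair_iso X Y -> pair_iso Y X.
Proof. by case=> /rmod_iso_sym ? /rmod_iso_sym. Qed.

Lemma pair_iso_trans X Y Z : pair_iso X Y -> pair_iso Y Z -> pair_iso X Z.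
Proof. by move=> [a b] [a' b']; split; apply: rmod_iso_trans; eassumption. Qed.

Lemma iso_presented_pair c X Y :
  pair_iso X Y -> presented_pair c X -> presented_pair c Y.
Proof.
move=> [i1 i2] [p1 p2]; split; first exact: iso_presented p1.
exact: iso_in_add (rmod_iso_sym i2) p2.
Qed.

Lemma iso_pair_zero X Y : pair_iso X Y -> pair_zero X -> pair_zero Y.
Proof. by move=> [i1 i2] [/(rmod_iso_zero i1) ? /(rmod_iso_zero i2)]. Qed.

Lemma iso_tau_rigid_pair X Y :
  pair_iso X Y -> tau_rigid_pair X -> tau_rigid_pair Y.
Proof.
move=> [i1 i2] [t1 p2 h]; split.
- exact: iso_tau_rigid i1 t1.
- apply: (@in_add_projective _ _ 1).
  exact: iso_in_add (rmod_iso_sym i2) (projective_in_add1 p2).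
have /rmod_isoP[u [v [hu hv uK vK]]] := i1.
have /rmod_isoP[u' [v' [hu' hv' uK' vK']]] := i2.
move=> g hg; apply/lfunP => x.
have /lfunP/(_ (v' x)) := h _ (comp_rhom (comp_rhom hv hg) hu').
rewrite !comp_lfunE vK' !zero_lfunE => vg.
by rewrite -(vK (g x)) vg linear0.
Qed.

Lemma iso_indecomposable_pair X Y :
  pair_iso X Y -> indecomposable_pair X -> indecomposable_pair Y.
Proof.
move=> XY [nX dX]; split=> [/(iso_pair_zero (pair_iso_sym XY))//|A B YAB].
exact/dX/(pair_iso_trans XY).
Qed.

Lemma dsum_pair_iso X Y X' Y' :
  pair_iso X X' -> pair_iso Y Y' -> pair_iso (dsum_pair X Y) (dsum_pair X' Y').
Proof. by move=> [a b] [a' b']; split; apply: dsum_iso. Qed.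

Lemma bigdsum_pair_iso (I : Type) (s : seq I) (X Y : I -> rpair L) :
  (forall i, pair_iso (X i) (Y i)) ->
  pair_iso (bigdsum_pair (map X s)) (bigdsum_pair (map Y s)).
Proof.
move=> XY; elim: s => [|i s IH] /=; first exact: pair_iso_refl.
exact: dsum_pair_iso.
Qed.

Lemma dsum_presented_pair c X Y :
  presented_pair c X -> presented_pair c Y -> presented_pair c (dsum_pair X Y).
Proof.
by move=> [a b] [a' b']; split; [apply: dsum_presented | apply: dsum_in_add].
Qed.

Lemma bigdsum_presented_pair c (I : Type) (s : seq I) (X : I -> rpair L) :
  (forall i, presented_pair c (X i)) -> presented_pair c (bigdsum_pair (map X s)).
Proof.
move=> pX; elim: s => [|i s IH] /=; last exact: dsum_presented_pair.
by split; [apply/in_add_presented/zero_in_add | apply: zero_in_add].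
Qed.

Section GVectors.
Variables (n : nat) (e : 'I_n -> L) (J : {set 'I_n}).
Hypothesis he : complete_primitive_idempotents e.
Let c := idem_sum e J.
Let cc : idempotent_elt c := idem_sum_idem J he.

Lemma idem_sum_mulr j : j \in J -> c * e j = e j.
Proof.
have [prim orth _] := he => jJ; rewrite mulr_suml (bigD1 j) //= big1.
  by rewrite addr0; case: (prim j).
by move=> i /andP[_ ij]; rewrite orth.
Qed.

Lemma in_add_proj_sum P : in_add c P -> exists a : 'I_n -> nat,
  (forall i, i \notin J -> a i = 0%N) /\ rmod_iso P (proj_sum e a).
Proof.
move=> [I [p [h [hh pc ch ph]]]]; have [prim _ _] := he.
have ee i : e i * e i = e i by have [] := prim i.
have hh' (x : I * 'I_n) : exists2 g : 'Hom(P, reg_rmod L), is_rhom g &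
    g =1 fun y => e x.2 * h x.1 y.
  apply: rhom_exists => [b y z|y b]; first by rewrite linearP mulrDr scalerAr.
  by rewrite hh /= mulrA.
have [h' hh1 hE] := fin_all_exists2 hh'.
(* The dual basis is refined along c = sum of the e_j: the member (i, j) is p_i e_j with e_j h_i,
   and only j in [J] contribute. *)
pose A := [set x : I * 'I_n | x.2 \in J].
have [|||y|s [sA iP]] := decompose_dual_basis prim (A := A) (t := snd)
  (p := fun x : I * 'I_n => ract (p x.1) (e x.2)) (h := h').
- exact: hh1.
- by move=> x; rewrite -ractA ee.
- by move=> x y; rewrite hE mulrA ee.
- transitivity (\sum_i \sum_(j in J) ract (ract (p i) (e j)) (h' (i, j) y)).
    rewrite {1}(ph y); apply: eq_bigr => i _.
    rewrite -{1}(ch i y) /c /idem_sum mulr_suml ract_sumr.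
    by apply: eq_bigr => j _; rewrite hE /= -ractA mulrA ee.
  by rewrite pair_big; apply: eq_big => [x|[i j] _] //=; rewrite inE.
exists (fun i => count_mem i s); split; last first.
  exact: rmod_iso_trans iP (bigdsum_proj_sum _ _).
move=> i iJ; apply/count_memPn; apply: contraNN iJ => /sA/imsetP[x].
by rewrite inE => xJ ->.
Qed.

Lemma gvector_of_presented X : tau_rigid_pair X -> presented_pair c X ->
  exists2 g, is_gvector e X g & forall i, i \notin J -> g i = 0.
Proof.
move=> [/tau_rigidP[P1 [P0 [f [p [mfp _]]]]] _ _] [pX1 pX2].
have [h1 h0] := min_presentation_in_add cc pX1 mfp.
have [a [a0 ia]] := in_add_proj_sum h0.
have [b [b0 ib]] := in_add_proj_sum (dsum_in_add h1 pX2).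
exists (fun i => (a i)%:Z - (b i)%:Z); first by exists P1, P0, f, p, a, b.
by move=> i iJ; rewrite a0 // b0 // subrr.
Qed.

Lemma proj_sum_in_add a : (forall i, i \notin J -> a i = 0%N) ->
  in_add c (proj_sum e a).
Proof.
have [prim _ _] := he => a0; rewrite proj_sumE; apply: bigdsum_in_add => // i.
rewrite -has_pred1 has_count count_expand => ai.
have iJ : i \in J by apply: contraLR ai => /a0 ->.
by split; [apply: idem_sum_mulr | apply: idem_sum_mull].
Qed.

Lemma retract_proj_sum a i : (0 < a i)%N -> retract (pid_rmod (e i)) (proj_sum e a).
Proof.
move=> ai; rewrite proj_sumE; apply: retract_bigdsum.
by rewrite -has_pred1 has_count count_expand.
Qed.

Lemma presented_of_gvector X g : tau_rigid_pair X -> is_gvector e X g ->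
  (forall i, i \notin J -> g i = 0) -> presented_pair c X.
Proof.
move=> [/tau_rigidP[Q1 [Q0 [f0 [p0 [mfp0 fac0]]]]] _ h0].
move=> [P1 [P0 [f [p [a [b [mfp ia ib gE]]]]]]] gJ.
(* The presentation behind the g-vector may differ from the one witnessing rigidity, so the
   factorization property is first moved to it. *)
have fac := min_presentation_factors mfp mfp0 fac0.
have ab i : i \notin J -> a i = 0%N /\ b i = 0%N.
  move=> iJ; have abi : a i = b i.
    by have /eqP := gJ i iJ; rewrite gE subr_eq0 => /eqP[].
  suff: a i = 0%N by rewrite -abi.
  apply/eqP; rewrite eqn0Ngt; apply/negP => ai.
  have E0 : rmod_zero (pid_rmod (e i)).
    apply: (rigid_no_common_summand mfp fac h0).
      exact: retract_trans (retract_proj_sum ai) (iso_retract (rmod_iso_sym ia)).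
    rewrite abi in ai.
    exact: retract_trans (retract_proj_sum ai) (iso_retract (rmod_iso_sym ib)).
  have [prim _ _] := he; have [ee e0 _] := prim i.
  have [u uE] := pid_val ee; case/eqP: e0.
  by rewrite -uE (E0 u) linear0.
have hP0 : in_add c P0.
  by apply: iso_in_add ia (proj_sum_in_add _) => i /ab[].
have hPX : in_add c (dsum_rmod P1 X.2).
  by apply: iso_in_add ib (proj_sum_in_add _) => i /ab[].
split; last exact: retract_in_add (retract_dsumr _ _) hPX.
have [[_ hp _] limp [_ hf _] fp] := mfp.
exists P1, P0, f, p; split=> //.
exact: retract_in_add (retract_dsuml _ _) hPX.
Qed.
End GVectors.
End Pairs.

(** * The isomorphism of complexes *)

Section IsoClasses.
Variables (k : fieldType) (A : falgType k).
Implicit Types X Y : rpair A.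

(** Classes are predicates, so isomorphic pairs have equal classes by functional and propositional
    extensionality. *)
Lemma iso_classP X Y : iso_class X = iso_class Y <-> pair_iso X Y.
Proof.
split=> [E|XY]; first by have : iso_class Y Y := pair_iso_refl Y; rewrite -E.
apply: functional_extensionality => Z; apply: propositional_extensionality.
by split; [apply/pair_iso_trans/pair_iso_sym | apply: pair_iso_trans].
Qed.

Lemma iso_indec_tau_rigid_pair X Y :
  pair_iso X Y -> indec_tau_rigid_pair X -> indec_tau_rigid_pair Y.
Proof.
move=> XY [iX tX]; split; first exact: iso_indecomposable_pair iX.
exact: iso_tau_rigid_pair tX.
Qed.
End IsoClasses.

(** * Restriction of pairs and the map on isomorphism classes *)

Section RestrictedPairs.
Variables (k : fieldType) (L : falgType k) (c : L).
Hypotheses (cc : idempotent_elt c) (c0 : c != 0).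
Implicit Types X Y Z : rpair L.
Let G : falgType k := subvs_of (corner cc c0).
Local Notation res := (res_rmod cc c0).

Definition res_pair X : rpair G := (res X.1, res X.2).

Lemma res_pair_iso X Y : pair_iso X Y -> pair_iso (res_pair X) (res_pair Y).
Proof. by move=> [a b]; split; apply: res_iso. Qed.

Lemma presented_pair_iso X Y : presented_pair c X -> presented_pair c Y ->
  pair_iso (res_pair X) (res_pair Y) -> pair_iso X Y.
Proof.
move=> [X1 X2] [Y1 Y2] [i1 i2]; split; first exact: presented_iso i1.
by apply: presented_iso i2; apply: in_add_presented.
Qed.

Lemma induced_pair (Z : rpair G) : projective Z.2 ->
  exists2 X, presented_pair c X & pair_iso (res_pair X) Z.
Proof.
move=> pZ; have [M pM iM] := induced_module Z.1.
have [P pP iP] := induced_module Z.2; exists (M, P) => //; split=> //.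
apply/(in_add_res pP)/(@in_add_projective _ _ 1).
exact/(iso_in_add iP)/projective_in_add1.
Qed.

Lemma res_dsum_pair X Y : pair_iso (res_pair (dsum_pair X Y))
                                   (dsum_pair (res_pair X) (res_pair Y)).
Proof. by split; apply: res_dsum. Qed.

Lemma res_bigdsum_pair (s : seq (rpair L)) :
  pair_iso (res_pair (bigdsum_pair s)) (bigdsum_pair (map res_pair s)).
Proof.
elim: s => [|X s IH] /=.
  by split; apply: zero_iso; try exact: zero_rmod_zero;
    apply/res_zero/zero_rmod_zero.
apply: pair_iso_trans (res_dsum_pair _ _) _.
by apply: dsum_pair_iso => //; apply: pair_iso_refl.
Qed.

Lemma projective_res X : presented_pair c X -> projective (res_pair X).2.
Proof. by move=> [_ /res_in_add/in_add_projective]; apply. Qed.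

Lemma res_pair_zero X : pair_zero X -> pair_zero (res_pair X).
Proof. by move=> [a b]; split; apply: res_zero. Qed.

Lemma res_pair_zeroI X : generated_by c X.1 -> generated_by c X.2 ->
  pair_zero (res_pair X) -> pair_zero X.
Proof.
by move=> g1 g2 [a b]; split;
  [apply: generated_res_zero g1 a | apply: generated_res_zero g2 b].
Qed.

(** A decomposition of the restriction lifts: the second components are summands of a projective, so
    both summands are induced from presented pairs. Conversely, the parts of a decomposition of [X]
    are generated by c, so they vanish once their restrictions do. *)
Lemma indecomposable_res X : presented_pair c X ->
  indecomposable_pair X <-> indecomposable_pair (res_pair X).
Proof.
move=> pX; have [/presented_generated g1 /in_add_generated g2] := pX.
split=> [[nX dX]|[nX dX]]; split.
- by move/(res_pair_zeroI g1 g2).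
- move=> A B XAB; have [_ /iso_retract rAB] := pair_iso_sym XAB.
  have prAB : in_add 1 (dsum_rmod A.2 B.2).
    exact/(retract_in_add rAB)/projective_in_add1/projective_res.
  have [|Y pY YA] := induced_pair (Z := A).
    exact/in_add_projective/(retract_in_add (retract_dsuml _ _) prAB).
  have [|Z pZ ZB] := induced_pair (Z := B).
    exact/in_add_projective/(retract_in_add (retract_dsumr _ _) prAB).
  have XYZ : pair_iso X (dsum_pair Y Z).
    apply: presented_pair_iso => //; first exact: dsum_presented_pair.
    apply: pair_iso_trans XAB _; apply: pair_iso_sym.
    exact/(pair_iso_trans (res_dsum_pair _ _))/dsum_pair_iso.
  have [/res_pair_zero/(iso_pair_zero YA)|/res_pair_zero/(iso_pair_zero ZB)] :=
    dX _ _ XYZ; by [left | right].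
- by move/res_pair_zero.
move=> Y Z XYZ; have [/rmod_iso_sym/iso_retract r1 /rmod_iso_sym/iso_retract r2] := XYZ.
have gD1 := retract_generated_by r1 g1; have gD2 := retract_generated_by r2 g2.
have [z|z] := dX _ _ (pair_iso_trans (res_pair_iso XYZ) (res_dsum_pair _ _)).
  left; apply: res_pair_zeroI z.
    exact: retract_generated_by (retract_dsuml _ _) gD1.
  exact: retract_generated_by (retract_dsuml _ _) gD2.
right; apply: res_pair_zeroI z.
  exact: retract_generated_by (retract_dsumr _ _) gD1.
exact: retract_generated_by (retract_dsumr _ _) gD2.
Qed.

Lemma tau_rigid_pair_res X : presented_pair c X ->
  tau_rigid_pair X <-> tau_rigid_pair (res_pair X).
Proof.
move=> pX; have [p1 p2] := pX; have q2 := in_add_presented p2.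
split=> [[t1 _ /(hom_zero_res cc c0 _ q2) h]|[t1 _ /(hom_zero_res cc c0 _ q2) h]].
  by split=> //; [apply: tau_rigid_res | apply: projective_res].
by split=> //; [apply: res_tau_rigid t1 | apply: in_add_projective p2].
Qed.

Lemma indec_tau_rigid_pair_res X : presented_pair c X ->
  indec_tau_rigid_pair X <-> indec_tau_rigid_pair (res_pair X).
Proof.
move=> pX; have := indecomposable_res pX; have := tau_rigid_pair_res pX.
by rewrite /indec_tau_rigid_pair; tauto.
Qed.

(** The preimage of a class under restriction, among presented pairs; on classes this is the effect
    of tensoring with cL over [G]. *)
Definition induced_class (v : rpair G -> Prop) : rpair L -> Prop :=
  fun Y => presented_pair c Y /\ v (res_pair Y).

Lemma induced_classE X :
  presented_pair c X -> induced_class (iso_class (res_pair X)) = iso_class X.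
Proof.
move=> pX; apply: functional_extensionality => Y.
apply: propositional_extensionality; split=> [[pY]|XY].
  exact: presented_pair_iso.
by split; [apply: iso_presented_pair XY pX | apply: res_pair_iso].
Qed.

Lemma vertex_res v : sc_vertex (s := support_tau_tilting_complex G) v ->
  exists X, [/\ presented_pair c X, indec_tau_rigid_pair X
              & v = iso_class (res_pair X)].
Proof.
move=> [Z tZ ->]; have [_ [_ pZ _]] := tZ; have [X pX XZ] := induced_pair pZ.
exists X; split=> //; last exact/iso_classP/pair_iso_sym.
exact/(indec_tau_rigid_pair_res pX)/(iso_indec_tau_rigid_pair (pair_iso_sym XZ)).
Qed.
End RestrictedPairs.

Theorem theorem1p1 (k : closedFieldType) (L : falgType k) (hL : basic_algebra L)
    (n : nat) (e : 'I_n -> L) (he : complete_primitive_idempotents e)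
    (J : {set 'I_n}) (hJ : J != set0) :
  sc_iso (support_tau_tilting_complex (idem_corner he hJ))
    (induced_subcomplex (K := support_tau_tilting_complex L)
       (gvector_supported e J)).
Proof.
pose c := idem_sum e J; pose cc := idem_sum_idem J he.
pose c0 := idem_sum_neq0 he hJ.
pose res := @res_pair k L c cc c0; pose phi := @induced_class k L c cc c0.
have phiE X : presented_pair c X -> phi (iso_class (res X)) = iso_class X.
  exact: induced_classE.
(* The support condition speaks of some representative of the class, and both tau-rigidity and being
   presented pass along isomorphisms. *)
have suppP X : tau_rigid_pair X ->
    gvector_supported e J (iso_class X) <-> presented_pair c X.
  move=> tX; split=> [[Y /iso_classP XY [g gY gJ]]|pX].
    apply: iso_presented_pair (pair_iso_sym XY) _.
    exact: (presented_of_gvector he (iso_tau_rigid_pair XY tX) gY gJ).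
  by exists X => //; apply: gvector_of_presented.
have resI X Y : presented_pair c X -> presented_pair c Y ->
    iso_class (res X) = iso_class (res Y) <-> iso_class X = iso_class Y.
  move=> pX pY; split=> /iso_classP XY; apply/iso_classP.
    exact: presented_pair_iso XY.
  exact: res_pair_iso.
exists phi; split.
- move=> v /vertex_res[X [pX tX ->]]; rewrite phiE //; split; first by exists X.
  by apply/(suppP _ (proj2 tX)).
- move=> v v' /vertex_res[X [pX _ ->]] /vertex_res[Y [pY _ ->]].
  by rewrite !phiE // => /resI ->.
- move=> w [[X tX ->] sX]; have pX : presented_pair c X.
    exact/(suppP _ (proj2 tX)).
  exists (iso_class (res X)); last by rewrite phiE.
  by exists (res X) => //; apply/(indec_tau_rigid_pair_res cc c0 pX).
move=> F vF; split=> [[m [Z [tZ Zinj FZ tsum]]]|[[m [X [tX Xinj FX tsum]]] _]].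
  (* The given representatives over [G] are replaced by restrictions of presented pairs, so that the
     face is tested on one direct sum over [L]. *)
  have hX i : exists X, presented_pair c X /\ pair_iso (res X) (Z i).
    have [_ [_ pZ _]] := tZ i.
    by have [X ? ?] := induced_pair (cc := cc) (c0 := c0) pZ; exists X.
  have [X XP] := fin_all_exists hX.
  have pX i : presented_pair c (X i) by have [] := XP i.
  have XZ i : iso_class (Z i) = iso_class (res (X i)).
    by apply/iso_classP/pair_iso_sym; have [] := XP i.
  have tX i : indec_tau_rigid_pair (X i).
    apply/(indec_tau_rigid_pair_res cc c0 (pX i)).
    apply: iso_indec_tau_rigid_pair (tZ i); exact/iso_classP/XZ.
  split; last first.
    move=> w [v Fv ->]; have [i ->] := (FZ v).1 Fv; rewrite XZ phiE //.
    exact/(suppP _ (proj2 (tX i))).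
  exists m, X; split=> //.
  - by move=> i j /(resI _ _ (pX i) (pX j)); rewrite -!XZ => /Zinj.
  - move=> w; split=> [[v Fv ->]|[i ->]].
      by have [i ->] := (FZ v).1 Fv; exists i; rewrite XZ phiE.
    exists (iso_class (Z i)); first by apply/FZ; exists i.
    by rewrite XZ phiE.
  have pS : presented_pair c (bigdsum_pair [seq X i | i <- enum 'I_m]).
    exact: bigdsum_presented_pair.
  apply/(tau_rigid_pair_res cc c0 pS); apply: iso_tau_rigid_pair tsum.
  apply: pair_iso_sym; apply: pair_iso_trans (res_bigdsum_pair _ _ _) _.
  rewrite -map_comp; apply: bigdsum_pair_iso => i /=.
  by have [] := XP i.
(* The class of X_i is some [phi] v, and all members of [phi] v are presented by construction. *)
have pX i : presented_pair c (X i).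
  have [v _ E] := (FX (iso_class (X i))).2 (ex_intro _ i erefl).
  have : iso_class (X i) (X i) by apply: pair_iso_refl.
  by rewrite E => -[].
exists m, (fun i => res (X i)); split.
- by move=> i; apply/(indec_tau_rigid_pair_res cc c0 (pX i)).
- by move=> i j /(resI _ _ (pX i) (pX j))/Xinj.
- move=> v; split=> [Fv|[i ->]].
    (* An element of F is recognised by its image: both are classes of presented pairs, and
       restriction reflects their equality. *)
    have [i] := (FX (phi v)).1 (ex_intro2 _ _ v Fv erefl).
    have [Y [pY _ ->]] := vertex_res (vF _ Fv).
    by rewrite phiE // => /resI; exists i; auto.
  have [w Fw] := (FX (iso_class (X i))).2 (ex_intro _ i erefl).
  have [Y [pY _ wY]] := vertex_res (vF _ Fw).
  by rewrite wY phiE // => /(resI _ _ (pX i) pY) ->; rewrite -wY.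
have pS : presented_pair c (bigdsum_pair [seq X i | i <- enum 'I_m]).
  exact: bigdsum_presented_pair.
have := (tau_rigid_pair_res cc c0 pS).1 tsum; apply: iso_tau_rigid_pair.
by rewrite (map_comp res X); apply: res_bigdsum_pair.
Qed.
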